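(* Let $\alpha,\beta>-1$ be real, put $\rho_\alpha=\frac{\alpha}{2}+\frac14$ and $\rho_\beta=\frac{\beta}{2}+\frac14$, and suppose that $0\le\rho_\alpha\le\frac12$ and $0\le\rho_\beta\le\frac12$. For each integer $n\ge1$ let $\psi_1^\ast,\dots,\psi_n^\ast\in[0,\pi]$ be such that $\cos\psi_1^\ast,\dots,\cos\psi_n^\ast$ are the zeros of the Jacobi polynomial $P_n^{(\alpha,\beta)}$, so that $\prod_{k=1}^n(x-\cos\psi_k^\ast)$ is the monic Jacobi polynomial of degree $n$. Then for every $n\ge 1$ $$\max_{x\in[-1,1]}(1-x)^{\rho_\alpha}(1+x)^{\rho_\beta}\left|\prod_{k=1}^n(x-\cos\psi_k^\ast)\right|\le 2^{1-n-\rho_\alpha-\rho_\beta},$$ with equality if and only if $\rho_\alpha,\rho_\beta\in\{0,\tfrac12\}$ (i.e. both parameters belong to this set).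
   Context: For $\alpha,\beta>-1$, $P_n^{(\alpha,\beta)}$ denotes the classical Jacobi polynomial: a polynomial of exact degree $n$, with $\int_{-1}^1(1-x)^\alpha(1+x)^\beta P_m^{(\alpha,\beta)}(x)P_n^{(\alpha,\beta)}(x)\,dx=0$ for $m\ne n$. All its zeros lie in $[-1,1]$. Only the monic polynomial $\prod_{k=1}^n(x-\cos\psi_k^\ast)$ (the monic orthogonal polynomial of degree $n$ for the weight $(1-x)^\alpha(1+x)^\beta$ on $[-1,1]$) matters, so the normalization of $P_n^{(\alpha,\beta)}$ is irrelevant. A factor with exponent $0$ is identically $1$. *)

(* Defs.v *)
From HB Require Import structures.
From mathcomp Require Import all_boot all_order all_algebra.
From mathcomp Require Import all_classical all_reals all_analysis.

Set Implicit Arguments.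
Unset Strict Implicit.
Unset Printing Implicit Defensive.

Import Order.TTheory GRing.Theory Num.Theory.
Import numFieldNormedType.Exports.

Local Open Scope classical_set_scope.
Local Open Scope ring_scope.

(* [powR] gives 0 `^ 0 = 1, so a factor with exponent 0 is identically 1 on
   [-1, 1].  For a negative exponent the value at the corresponding endpoint is
   the conventional 0 `^ a = 0; this only affects a null set in integrals. *)
Definition jacobi_weight (R : realType) (a b x : R) : R :=
  (1 - x) `^ a * (1 + x) `^ b.

(* For a, b > -1 this determines each [P n] up to a nonzero scalar.
   [size p = n.+1] means that p has exact degree n. *)
Definition is_jacobi_family (R : realType) (a b : R) (P : nat -> {poly R}) :
    Prop :=
  (forall n : nat, size (P n) = n.+1) /\
  (forall m n : nat, m <> n ->
     \int[@lebesgue_measure R]_(x in `[-1, 1])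
       (jacobi_weight a b x * (P m).[x] * (P n).[x]) = 0).

(* z lists the zeros of p, repeated according to multiplicity. *)
Definition are_the_zeros (R : realType) (n : nat) (p : {poly R})
    (z : 'I_n -> R) : Prop :=
  p != 0 /\ p = lead_coef p *: \prod_(k < n) ('X - (z k)%:P).

Definition rho (R : realType) (a : R) : R := a / 2 + 1 / 4.

Definition is_max (R : realType) (A : set R) (M : R) : Prop :=
  A M /\ ubound A M.

(* Main.v *)
(* Let r = rho alpha, s = rho beta, N = n + r + s, and let Q be the monic
   Jacobi polynomial.  With x = cos theta the function
   u(theta) = (1 - x)^r (1 + x)^s Q(x) satisfies u'' + Phi u = 0, where
   Phi = N^2 + r (1 - 2 r) / (1 - x) + s (1 - 2 s) / (1 + x) >= N^2.
   Sonin's function u^2 + u'^2 / Phi is maximal where Phi is minimal, say at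
   x = c, so u^2 <= D := u(c)^2 + u'(c)^2 / N^2.  Continue u from
   theta = arccos c along the vertical line theta + i y.  There Re Phi >= N^2,
   and Im Phi has the right sign, so that |u(theta + i y)|^2 dominates the
   solution with Phi = N^2, which grows like (D / 4) e^(2 N y).  On the other
   hand |cos(theta + i y) - t| <= cosh y + 1 for t in [-1, 1] gives
   |u|^2 <= (cosh y + 1)^(2 N), which grows like (e^y / 2)^(2 N).  Comparing the
   two as y tends to infinity yields D <= 4^(1 - N).  If Phi is not constant
   then the lower bound improves by a definite factor; if it is constant then
   all these inequalities are equalities. *)
Require Import Defs.
From HB Require Import structures.
From mathcomp Require Import all_boot all_order all_algebra.
From mathcomp Require Import all_classical all_reals all_analysis measurable_realfun.
From mathcomp Require Import complex ring lra.

Set Implicit Arguments.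
Unset Strict Implicit.
Unset Printing Implicit Defensive.

Import Order.TTheory GRing.Theory Num.Theory.
Import numFieldNormedType.Exports.

Local Open Scope classical_set_scope.
Local Open Scope ring_scope.

(** Complex powers of 1 - x and 1 + x would require branches along the vertical line. Only |u|^2,
    |u'|^2 and conj(u) u' occur, and there the powers enter through the real weight |1 - x|^(2 r) |1
    + x|^(2 s), where |1 - cos(theta + i y)| = cosh y - cos theta. So the argument runs on real
    differential inequalities in y. With a = r (1 - 2 r) and b = s (1 - 2 s), the reflection x -> -x
    permits a <= b. When a = 0 < b, the minimum of Phi sits at x = 1, where the vertical line starts
    at a singularity. Hence c is only required to satisfy a (1 + c)^2 <= b (1 - c)^2, which says
    Phi' <= 0 at c, and c may depend on x. The improvement factor must therefore be free of c; it
    exceeds 1 exactly when b > 0. The differential equation has to be extracted from orthogonality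
    alone, by symmetry of the Jacobi operator. The weight may be unbounded at the endpoints, so
    integration by parts rests on an improper fundamental theorem. *)

(* Not a class, unlike [is_derive]: derivatives are left as unification
   variables below, and resolution must not guess them. *)
Definition drv (R : realType) (f : R -> R) (x a : R) : Prop := is_derive x 1 f a.

(** * Derivative rules and monotonicity for real functions *)

Section DerivativeRules.
Variable R : realType.
Implicit Types (f g : R -> R) (x a b c u v : R).

Lemma drv_eq f x a b : drv f x a -> a = b -> drv f x b.
Proof. by move=> df <-. Qed.

Lemma drvC c x : drv (fun=> c) x 0.
Proof. exact: is_derive_cst. Qed.

Lemma drv_id x : drv (fun t => t) x 1.
Proof. exact: is_derive_id. Qed.

Lemma drvD f g x a b : drv f x a -> drv g x b ->
  drv (fun t => f t + g t) x (a + b).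
Proof. by move=> ? ?; exact: is_deriveD. Qed.

Lemma drvN f x a : drv f x a -> drv (fun t => - f t) x (- a).
Proof. by move=> ?; exact: is_deriveN. Qed.

Lemma drvM f g x a b : drv f x a -> drv g x b ->
  drv (fun t => f t * g t) x (a * g x + f x * b).
Proof.
rewrite /drv => df dg; apply: is_derive_eq.
by rewrite -![_ *: _]/(_ * _); ring.
Qed.

Lemma drvX f n x a : drv f x a ->
  drv (fun t => f t ^+ n) x (n%:R * f x ^+ n.-1 * a).
Proof.
rewrite /drv => df.
have -> : (fun t => f t ^+ n) = f ^+ n by apply/funext => t; rewrite fctE.
by apply: is_derive_eq.
Qed.

Lemma drvV f x a : f x != 0 -> drv f x a ->
  drv (fun t => (f t)^-1) x (- a / f x ^+ 2).
Proof.
rewrite /drv => fx0 df; have := is_deriveV fx0 df => /is_derive_eq; apply.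
by rewrite -![_ *: _]/(_ * _) !mulNr mulrC.
Qed.

Lemma drv_comp f g x a b : drv f (g x) a -> drv g x b ->
  drv (fun t => f (g t)) x (a * b).
Proof. by move=> ? ?; exact: is_derive1_comp. Qed.

Lemma drv_expR f x a : drv f x a ->
  drv (fun t => expR (f t)) x (expR (f x) * a).
Proof. by move=> df; apply: drv_comp => //; exact: is_derive_expR. Qed.

(** Stated with the quotient by [f x] instead of the exponent [p - 1], so that [field] meets a
    single power of each base. *)
Lemma drv_powR f x a p : 0 < f x -> drv f x a ->
  drv (fun t => f t `^ p) x (p * a * f x `^ p / f x).
Proof.
move=> fx0 df.
have h : drv (fun t => t `^ p) (f x) (p * f x `^ (p - 1)).
  exact: (@is_derive1_powR R p (f x) fx0).
apply: drv_eq (drv_comp h df) _.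
rewrite powRB; last by rewrite (gt_eqF fx0) implybT.
by rewrite powRr1 ?ltW //; ring.
Qed.

Lemma drv_horner (p : {poly R}) f x a : drv f x a ->
  drv (fun t => p.[f t]) x (p^`().[f x] * a).
Proof. by move=> df; apply: drv_comp df; exact: is_derive_poly. Qed.

Lemma drv_continuous f x a : drv f x a -> {for x, continuous f}.
Proof.
by move=> [df _]; exact/differentiable_continuous/derivable1_diffP.
Qed.

Lemma drv_within_continuous f (f' : R -> R) u v :
  (forall t, u <= t <= v -> drv f t (f' t)) -> {within `[u, v], continuous f}.
Proof.
move=> df; apply: derivable_within_continuous => t; rewrite in_itv /= => tuv.
by have [] := df t tuv.
Qed.

Lemma drv_nondecreasing f (f' : R -> R) u v : u <= v ->
  (forall t, u <= t <= v -> drv f t (f' t)) ->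
  (forall t, u <= t <= v -> 0 <= f' t) -> f u <= f v.
Proof.
move=> uv df f'0.
have [||t] := @MVT_segment _ f f' u v uv.
- by move=> t; rewrite in_itv /= => /andP[/ltW ut /ltW tv]; apply: df; rewrite ut.
- exact: drv_within_continuous df.
rewrite in_itv /= => tuv e.
by rewrite -subr_ge0 e mulr_ge0 ?f'0 // subr_ge0.
Qed.

Lemma drv_nonincreasing f (f' : R -> R) u v : u <= v ->
  (forall t, u <= t <= v -> drv f t (f' t)) ->
  (forall t, u <= t <= v -> f' t <= 0) -> f v <= f u.
Proof.
move=> uv df f'0; rewrite -lerN2.
apply: (@drv_nondecreasing (fun t => - f t) (fun t => - f' t)) => // t tuv.
  exact: drvN (df t tuv).
by rewrite oppr_ge0 f'0.
Qed.

(** Squaring removes the corner of the negative part: at 0 the difference quotient is [min t 0]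
    itself, which is continuous there with value 0. *)
Lemma drv_min0_sq x : drv (fun t => Num.min t 0 ^+ 2) x (2 * Num.min x 0).
Proof.
rewrite /drv; have [x0|x0|->] := ltgtP x 0.
- apply: (@near_eq_is_derive R R R (fun t : R => t ^+ 2)).
    by apply: filterS (lt_nbhsl x0) => t /ltW t0; rewrite min_l.
  by apply: drv_eq; [exact: drvX (drv_id x)|rewrite /= expr1 mulr1].
- apply: (@near_eq_is_derive R R R (fun t : R => 0)).
    have x0' : - x < 0 by rewrite oppr_lt0.
    apply: filterS (Nlt_nbhsl x0') => t; rewrite oppr_lt0 => /ltW t0.
    by rewrite min_r // expr0n.
  by rewrite mulr0; exact: drvC.
- apply/is_derive1_caratheodory; exists (fun t => Num.min t 0); split.
  + move=> t; rewrite subr0 minxx expr0n /= subr0.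
    by have [t0|t0] := leP t 0; rewrite ?expr2 ?mul0r.
  + by apply: continuous_min; [exact: cvg_id|exact: cvg_cst].
  + by rewrite minxx mulr0.
Qed.

End DerivativeRules.

Ltac auto_drv_core :=
  first [solve [apply: drvC] |
  lazymatch goal with
  | |- drv (fun t => t) _ _ => apply: drv_id
  | |- drv (fun t => @?f t + @?g t) _ _ =>
       apply: (@drvD _ f g); auto_drv_core
  | |- drv (fun t => - @?f t) _ _ => apply: (@drvN _ f); auto_drv_core
  | |- drv (fun t => @?f t * @?g t) _ _ =>
       apply: (@drvM _ f g); auto_drv_core
  | |- drv (fun t => @?f t ^+ ?n) _ _ =>
       apply: (@drvX _ f n); auto_drv_core
  | |- drv (fun t => (@?f t)^-1) _ _ =>
       apply: (@drvV _ f); [|auto_drv_core]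
  | |- drv (fun t => expR (@?f t)) _ _ =>
       apply: (@drv_expR _ f); auto_drv_core
  | |- drv (fun t => @?f t `^ ?p) _ _ =>
       apply: (@drv_powR _ f _ _ p); [|auto_drv_core]
  | |- drv (fun t => horner ?p (@?f t)) _ _ =>
       apply: (@drv_horner _ p f); auto_drv_core
  | |- _ => try eassumption
  end].
Ltac auto_drv := apply: drv_eq; [auto_drv_core|].

(* The squared negative parts of Z, X, D satisfy a Gronwall inequality. *)
Lemma comparison_ge0 (R : realType) (Z X D X' D' g : R -> R) (c G : R) :
  0 <= c ->
  (forall y, drv Z y (X y)) -> (forall y, drv X y (X' y)) ->
  (forall y, drv D y (D' y)) ->
  (forall y, 0 <= y -> c * Z y + 2 * D y <= X' y) ->
  (forall y, 0 <= y -> g y * X y <= D' y) ->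
  (forall y, 0 <= y -> 0 <= g y <= G) ->
  Z 0 = 0 -> X 0 = 0 -> D 0 = 0 ->
  forall y, 0 <= y -> [/\ 0 <= Z y, 0 <= X y & 0 <= D y].
Proof.
move=> c0 dZ dX dD hX hD hg Z0 X0 D0 y y0.
pose m (x : R) := Num.min x 0.
pose V y := m (Z y) ^+ 2 + m (X y) ^+ 2 + m (D y) ^+ 2.
pose L := 3 + c + G.
have dm (f : R -> R) (f' t : R) : drv f t f' ->
    drv (fun t => m (f t) ^+ 2) t (2 * m (f t) * f').
  by move=> df; exact: drv_comp (drv_min0_sq (f t)) df.
have m0 x : m x <= 0 by rewrite /m ge_min lexx orbT.
have mx x : m x <= x by rewrite /m ge_min lexx.
(* Because m x <= 0 <= z - m z. With c >= 0 and g >= 0 this bounds V' by a quadratic form in the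
   negative parts, which L V dominates. *)
have mM x z : m x * z <= m x * m z by rewrite ler_wnM2l.
have VL : expR (- L * y) * V y <= expR (- L * 0) * V 0.
  apply: (@drv_nonincreasing _ (fun t => expR (- L * t) * V t)
    (fun t => expR (- L * t) * (- L * V t + 2 * m (Z t) * X t +
       2 * m (X t) * X' t + 2 * m (D t) * D' t)) 0 y y0) => t /andP[t0 _].
    auto_drv.
      apply: drvD; [apply: drvD|]; apply: dm; [exact: dZ|exact: dX|exact: dD].
    by rewrite /=; ring.
  rewrite pmulr_rle0 ?expR_gt0 //.
  have [g0 gG] := andP (hg t t0).
  have h1 := mM (Z t) (X t).
  have h2 : m (X t) * X' t <= m (X t) * (c * m (Z t) + 2 * m (D t)).
    rewrite ler_wnM2l //; apply: le_trans (hX t t0).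
    by rewrite lerD // ler_wpM2l.
  have h3 : m (D t) * D' t <= m (D t) * (g t * m (X t)).
    rewrite ler_wnM2l //; apply: le_trans (hD t t0).
    by rewrite ler_wpM2l.
  have h4 : 0 <= c * (m (X t) - m (Z t)) ^+ 2 by rewrite mulr_ge0 ?sqr_ge0.
  have h5 : 0 <= g t * (m (D t) - m (X t)) ^+ 2 by rewrite mulr_ge0 ?sqr_ge0.
  have h6 := sqr_ge0 (m (X t) - m (Z t)).
  have h7 := sqr_ge0 (m (X t) - m (D t)).
  have h8 : 0 <= (G - g t) * (m (D t) ^+ 2 + m (X t) ^+ 2).
    by rewrite mulr_ge0 ?subr_ge0 ?addr_ge0 ?sqr_ge0.
  have h10 : 0 <= G * m (Z t) ^+ 2.
    by rewrite mulr_ge0 ?sqr_ge0 // (le_trans g0).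
  have h11 : 0 <= c * m (D t) ^+ 2 by rewrite mulr_ge0 ?sqr_ge0.
  rewrite /V /L.
  move: h1 h2 h3 h4 h5 h6 h7 h8 h10 h11.
  move: (sqr_ge0 (m (Z t))) (sqr_ge0 (m (D t))).
  lra.
have V0 : V y <= 0.
  move: VL; rewrite {2}/V Z0 X0 D0 /m minxx expr0n /= !addr0 mulr0.
  by rewrite pmulr_rle0 ?expR_gt0.
have z f : m (f y) ^+ 2 <= 0 -> 0 <= f y.
  move=> h; have : m (f y) == 0 by rewrite -sqrf_eq0 eq_le h sqr_ge0.
  by move=> /eqP <-.
have := sqr_ge0 (m (Z y)); have := sqr_ge0 (m (X y)); have := sqr_ge0 (m (D y)).
move: V0; rewrite /V => *.
by split; apply: z; lra.
Qed.

(** * Hyperbolic cosine and sine *)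

Section HyperbolicFunctions.
Variable R : realType.
Implicit Types (x y a : R) (f : R -> R).

Definition ch x : R := (expR x + expR (- x)) / 2.
Definition sh x : R := (expR x - expR (- x)) / 2.

Lemma drv_ch f x a : drv f x a -> drv (fun t => ch (f t)) x (sh (f x) * a).
Proof.
by move=> df; rewrite /ch /sh; auto_drv; [exact: df..|rewrite /=; ring].
Qed.

Lemma drv_sh f x a : drv f x a -> drv (fun t => sh (f t)) x (ch (f x) * a).
Proof.
by move=> df; rewrite /ch /sh; auto_drv; [exact: df..|rewrite /=; ring].
Qed.

Lemma ch0 : ch 0 = 1.
Proof. by rewrite /ch oppr0 expR0; field. Qed.

Lemma sh0 : sh 0 = 0.
Proof. by rewrite /sh oppr0 expR0; field. Qed.

Lemma ch2_sh2 x : ch x ^+ 2 = 1 + sh x ^+ 2.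
Proof.
have e : expR x * expR (- x) = 1 by rewrite -expRD subrr expR0.
rewrite /ch /sh; move: e; move: (expR x) (expR (- x)) => u v e.
have -> : ((u + v) / 2) ^+ 2 = u * v + ((u - v) / 2) ^+ 2 by field.
by rewrite e.
Qed.

Lemma ch_gt0 x : 0 < ch x.
Proof. by rewrite divr_gt0 // addr_gt0 // expR_gt0. Qed.

Lemma ch_ge1 x : 1 <= ch x.
Proof.
have : 1 <= ch x ^+ 2 by rewrite ch2_sh2 lerDl sqr_ge0.
by rewrite expr_ge1 // ltW // ch_gt0.
Qed.

Lemma sh_le x y : x <= y -> sh x <= sh y.
Proof.
move=> xy; have h1 : expR x <= expR y by rewrite ler_expR.
have h2 : expR (- y) <= expR (- x) by rewrite ler_expR lerN2.
by rewrite /sh; lra.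
Qed.

Lemma sh_ge0 x : 0 <= x -> 0 <= sh x.
Proof. by move=> /sh_le; rewrite sh0. Qed.

Lemma ch_le x y : 0 <= x -> x <= y -> ch x <= ch y.
Proof.
move=> x0 xy; have y0 := le_trans x0 xy.
rewrite -(@ler_pXn2r _ 2) ?nnegrE ?(ltW (ch_gt0 _)) //.
by rewrite !ch2_sh2 lerD2l ler_pXn2r ?nnegrE ?sh_ge0 // sh_le.
Qed.

Lemma ch_gt1 x : 0 < x -> 1 < ch x.
Proof.
move=> x0; have s0 : 0 < sh x.
  by rewrite divr_gt0 // subr_gt0 ltr_expR (lt_trans _ x0) // oppr_lt0.
have : 1 < ch x ^+ 2 by rewrite ch2_sh2 ltrDl exprn_gt0.
by rewrite expr_gt1 // ltW // ch_gt0.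
Qed.

Lemma chE x : ch x = (expR x + expR (- x)) / 2.
Proof. by []. Qed.

Lemma ch_ge_expR x : expR x / 2 <= ch x.
Proof. by rewrite /ch mulrDl lerDl divr_ge0 // expR_ge0. Qed.

End HyperbolicFunctions.

Global Opaque ch sh.

(** * Growth of the squared modulus along a vertical line *)

(* In the application S and T are the squared moduli of u and u' along a
   vertical line, where u'' = (fr + i fi) u, and J + i I = (conj u) u'.  The
   comparison function is the solution of the constant coefficient problem
   fr = N^2, fi = 0 with the same initial data. *)
Section VerticalLine.
Variables (R : realType) (N B : R) (fr fi S T J I : R -> R).
Hypothesis N1 : 1 <= N.
Hypotheses (dS : forall y, drv S y (2 * J y))
  (dJ : forall y, drv J y (T y + fr y * S y))
  (dI : forall y, drv I y (fi y * S y))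
  (dT : forall y, drv T y (2 * (fr y * J y + fi y * I y))).
Hypothesis J0 : J 0 = 0.

(** For fr = N^2 and fi = 0 the solution with the same initial data is S 0 + H (ch (2 N y) - 1),
    with T - N^2 S constant. [Z], [X] and [D] are the deviations of S, S' and T - N^2 S from it. The
    quantity named D in the overview is 2 H here. *)
Let H := (T 0 + N ^+ 2 * S 0) / (2 * N ^+ 2).
Let Z y := S y - S 0 - H * (ch (2 * N * y) - 1).
Let X y := 2 * J y - 2 * N * H * sh (2 * N * y).
Let D y := T y - N ^+ 2 * S y - (T 0 - N ^+ 2 * S 0).

Let X' y := 2 * (T y + fr y * S y) - 4 * N ^+ 2 * H * ch (2 * N * y).
Let D' y := 2 * (fr y * J y + fi y * I y) - 2 * N ^+ 2 * J y.

Let N0 : 0 < N. Proof. exact: lt_le_trans N1. Qed.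

Let dlin y : drv (fun t => 2 * N * t) y (2 * N).
Proof. by auto_drv; rewrite /=; ring. Qed.

Let dZ y : drv Z y (X y).
Proof.
rewrite /Z /X; auto_drv; [exact: dS|exact: drv_ch (dlin y)|].
by rewrite /=; ring.
Qed.

Let dX y : drv X y (X' y).
Proof.
rewrite /X /X'; auto_drv; [exact: dJ|exact: drv_sh (dlin y)|].
by rewrite /=; ring.
Qed.

Let dD y : drv D y (D' y).
Proof.
by rewrite /D /D'; auto_drv; [exact: dT|exact: dS|rewrite /=; ring].
Qed.

Let Z0 : Z 0 = 0.
Proof. by rewrite /Z mulr0 ch0; ring. Qed.

Let X0 : X 0 = 0.
Proof. by rewrite /X mulr0 sh0 J0; ring. Qed.

Let D0 : D 0 = 0.
Proof. by rewrite /D; ring. Qed.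

(** The forcing 2 (fr - N^2) S is nonnegative once fr >= N^2, which is the shape that
    [comparison_ge0] asks for. *)
Let X'E y : X' y = 4 * N ^+ 2 * Z y + 2 * D y + 2 * (fr y - N ^+ 2) * S y.
Proof.
rewrite /X' /Z /D /H.
by field; rewrite gt_eqF.
Qed.

(** With constant coefficients the comparison applies to the deviations and to their negatives,
    which forces Z = 0. *)
Lemma line_eq : (forall y, fr y = N ^+ 2) -> (forall y, fi y = 0) ->
  forall y, 0 <= y -> S y = S 0 + H * (ch (2 * N * y) - 1).
Proof.
move=> frE fiE y y0.
have N20 : 0 <= 4 * N ^+ 2 by rewrite mulr_ge0 // sqr_ge0.
have pos := @comparison_ge0 R Z X D X' D' (fun=> 0) (4 * N ^+ 2) 0 N20
  dZ dX dD.
have neg := @comparison_ge0 R (fun y => - Z y) (fun y => - X y)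
  (fun y => - D y) (fun y => - X' y) (fun y => - D' y) (fun=> 0) (4 * N ^+ 2) 0
  N20 (fun y => drvN (dZ y)) (fun y => drvN (dX y)) (fun y => drvN (dD y)).
have D'0 t : D' t = 0 by rewrite /D' frE fiE; ring.
have X'0 t : X' t = 4 * N ^+ 2 * Z t + 2 * D t by rewrite X'E frE; ring.
have [||||||Zp _ _] := pos _ _ _ _ _ _ y y0 => //.
- by move=> t _; rewrite X'0.
- by move=> t _; rewrite D'0 mul0r.
- by move=> t _; rewrite lexx.
have [||||||Zn _ _] := neg _ _ _ _ _ _ y y0.
- by move=> t _; rewrite X'0; lra.
- by move=> t _; rewrite D'0 mul0r oppr0.
- by move=> t _; rewrite lexx.
- by rewrite Z0 oppr0.
- by rewrite X0 oppr0.
- by rewrite D0 oppr0.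
have : Z y = 0 by apply/eqP; rewrite eq_le Zp andbT -oppr_ge0.
by rewrite /Z => h; move: h; set w := H * _ => h; lra.
Qed.

Hypotheses (frB : forall y, 0 <= y -> 0 <= fr y - N ^+ 2 <= B)
  (fi0 : forall y, 0 <= y -> 0 <= fi y)
  (fifr : forall y, 0 <= y -> fi y <= (fr y - N ^+ 2) * sh (2 * N * y))
  (S_ge0 : forall y, 0 <= S y) (T0_ge0 : 0 <= T 0)
  (I0 : - (N * H) <= I 0).

Let H0 : 0 <= H.
Proof.
apply: divr_ge0; last by apply: mulr_ge0; rewrite ?sqr_ge0.
by apply: addr_ge0 => //; apply: mulr_ge0; rewrite ?sqr_ge0.
Qed.

Let I_ge y : 0 <= y -> - (N * H) <= I y.
Proof.
move=> y0; apply: le_trans I0 _.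
apply: (@drv_nondecreasing _ I (fun t => fi t * S t) 0 y y0) => t /andP[t0 _].
  exact: dI.
by rewrite mulr_ge0 ?fi0.
Qed.

Let pos y : 0 <= y -> [/\ 0 <= Z y, 0 <= X y & 0 <= D y].
Proof.
move=> y0.
apply: (@comparison_ge0 _ Z X D X' D' (fun t => fr t - N ^+ 2) (4 * N ^+ 2) B _
  dZ dX dD) => // [|t t0|t t0].
- by rewrite mulr_ge0 // sqr_ge0.
- rewrite X'E lerDl mulr_ge0 // mulr_ge0 //.
  by case/andP: (frB t0).
- rewrite -subr_ge0.
  (* I may be negative but stays above - N H. The resulting loss 2 fi N H is paid for by the
     hyperbolic sine inside X, through [fifr]. *)
  have -> : D' t - (fr t - N ^+ 2) * X t = 2 * (fi t * (I t + N * H) +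
      N * H * ((fr t - N ^+ 2) * sh (2 * N * t) - fi t)).
    by rewrite /D' /X; ring.
  apply: mulr_ge0 => //; apply: addr_ge0; apply: mulr_ge0.
  + exact: fi0.
  + by have := I_ge t0; lra.
  + by rewrite mulr_ge0 // (ltW N0).
  + by rewrite subr_ge0 fifr.
Qed.

Lemma line_ge y : 0 <= y -> S 0 + H * (ch (2 * N * y) - 1) <= S y.
Proof.
move=> /pos[+ _ _]; rewrite /Z; set w := H * _ => h; lra.
Qed.

Variable d : R.
Hypothesis frd : forall y, 1 <= y <= 2 -> d <= fr y - N ^+ 2.
Hypothesis d0 : 0 <= d.

(** On [1, 2] the forcing 2 (fr - N^2) S is at least this constant, as S >= H (ch (2 N) - 1) there.
    Staying away from y = 0, where the lower bound for S degenerates, makes the constant a positive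
    multiple of d H. *)
Let X2 : 2 * d * H * (ch (2 * N) - 1) <= X 2.
Proof.
set A := 2 * d * H * (ch (2 * N) - 1).
have [_ X1 _] := pos ler01.
have h12 : (1 : R) <= 2 by rewrite ler1n.
suff : X 1 - A * 1 <= X 2 - A * 2 by lra.
apply: (@drv_nondecreasing _ (fun t => X t - A * t) (fun t => X' t - A) 1 2 h12)
    => t t12.
  by auto_drv; [exact: dX|rewrite /=; ring].
have t1 : 1 <= t by case/andP: t12.
have t0 : 0 <= t by apply: le_trans t1.
have [Zt _ Dt] := pos t0.
have fd := frd t12.
have St : H * (ch (2 * N) - 1) <= S t.
  apply: le_trans (line_ge t0); rewrite -[leLHS]add0r lerD //.
  rewrite ler_wpM2l // lerD2r ch_le // ?mulr_ge0 ?(ltW N0) //.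
  by rewrite -[leLHS]mulr1 ler_wpM2l // mulr_ge0 // ltW.
have h1 : 0 <= 4 * N ^+ 2 * Z t by apply: mulr_ge0 => //; rewrite mulr_ge0 ?sqr_ge0.
have h2 : d * (H * (ch (2 * N) - 1)) <= (fr t - N ^+ 2) * S t.
  rewrite ler_pM // mulr_ge0 // subr_ge0 ch_ge1 //.
by rewrite X'E /A; lra.
Qed.

(** A surplus in X at y = 2 does not die out: (X + 2 N Z)' >= 2 N (X + 2 N Z), so X + 2 N Z grows at
    least like e^(2 N y), and integrating (e^(2 N y) Z)' gives the same rate for Z. The extra term
    is proportional to H, so that it becomes a factor in the final bound. *)
Lemma line_ge_strict y : 2 <= y ->
  H * (ch (2 * N * y) - 1) + d * (ch (2 * N) - 1) / (2 * N) * expR (- (8 * N)) *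
     H * (expR (2 * N * y) - expR (8 * N)) <= S y.
Proof.
move=> y2.
have h02 : (0 : R) <= 2 by [].
have F t : 2 <= t -> expR (- (2 * N) * 2) * (X 2 + 2 * N * Z 2) <=
    expR (- (2 * N) * t) * (X t + 2 * N * Z t).
  move=> t2; apply: (@drv_nondecreasing _
      (fun t => expR (- (2 * N) * t) * (X t + 2 * N * Z t))
      (fun t => expR (- (2 * N) * t) * (X' t - 4 * N ^+ 2 * Z t)) 2 t t2) => r.
    by move=> _; auto_drv; [exact: dX|exact: dZ|rewrite /=; ring].
  move=> /andP[r2 _]; have r0 := le_trans h02 r2.
  have [_ _ Dr] := pos r0.
  rewrite mulr_ge0 ?expR_ge0 // X'E.
  have [fr0 _] := andP (frB r0).
  have := mulr_ge0 fr0 (S_ge0 r); lra.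
pose A := expR (- (2 * N) * 2) * X 2.
have [Z2 X2_ge0 _] := pos h02.
have AF t : 2 <= t -> A * expR (2 * N * t) <= X t + 2 * N * Z t.
  move=> t2; rewrite -ler_pdivlMr ?expR_gt0 // -expRN -mulNr mulrC.
  apply: le_trans (F t t2); rewrite ler_wpM2l ?expR_ge0 // lerDl.
  by rewrite !mulr_ge0 // ltW.
pose E t : R := expR (2 * N * t).
have dE t : drv E t (2 * N * E t).
  by rewrite /E; auto_drv; rewrite /=; ring.
have EZ : E 2 * Z 2 - A / (4 * N) * E 2 ^+ 2 <= E y * Z y - A / (4 * N) * E y ^+ 2.
  apply: (@drv_nondecreasing _ (fun t => E t * Z t - A / (4 * N) * E t ^+ 2)
    (fun t => E t * (X t + 2 * N * Z t - A * E t)) 2 y y2) => r.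
    move=> _; auto_drv; [exact: dE|exact: dZ|exact: dE|rewrite /=].
    by field; rewrite gt_eqF.
  by move=> /andP[r2 _]; rewrite mulr_ge0 ?expR_ge0 // subr_ge0 AF.
have E2 : E 2 = expR (4 * N) by rewrite /E; congr expR; ring.
have Ey0 : 0 < E y by exact: expR_gt0.
have E24 : E 2 ^+ 2 = expR (8 * N).
  by rewrite E2 expr2 -expRD; congr expR; ring.
have Ey1 : 1 <= E y.
  rewrite /E -[leLHS]expR0 ler_expR; apply: mulr_ge0; last exact: le_trans y2.
  by rewrite mulr_ge0 // ltW.
have A0 : 0 <= A by rewrite mulr_ge0 ?expR_ge0.
have ZA : A / (4 * N) * (E y - expR (8 * N)) <= Z y.
  have c0 : 0 <= A / (4 * N) by rewrite divr_ge0 // mulr_ge0 // ltW.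
  rewrite -(ler_pM2l Ey0).
  have h1 : 0 <= E 2 * Z 2 by rewrite mulr_ge0 ?expR_ge0.
  have h2 : A / (4 * N) * E 2 ^+ 2 <= A / (4 * N) * E 2 ^+ 2 * E y.
    by rewrite ler_peMr // mulr_ge0 // sqr_ge0.
  rewrite -E24; move: EZ h1 h2; set c := A / _; lra.
(* Up to e^(8 N) = (E 2)^2 the extra term is nonpositive and [line_ge] suffices. *)
have [Eyb|Eyb] := leP (E y) (expR (8 * N)).
  have := line_ge (le_trans h02 y2); apply: le_trans.
  rewrite addrC lerD // (@le_trans _ _ 0) ?S_ge0 //.
  rewrite mulr_ge0_le0 ?subr_le0 //; apply: mulr_ge0 => //.
  rewrite mulr_ge0 ?expR_ge0 // divr_ge0 ?mulr_ge0 ?(ltW N0) //.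
  by rewrite subr_ge0 ch_ge1.
(* A carries the factor e^(- 4 N), which is at least the e^(- 8 N) of the statement; the rest is
   [X2]. *)
have XA : d * (ch (2 * N) - 1) / (2 * N) * expR (- (8 * N)) * H <= A / (4 * N).
  have -> : d * (ch (2 * N) - 1) / (2 * N) * expR (- (8 * N)) * H =
    (expR (- (8 * N)) * (2 * d * H * (ch (2 * N) - 1))) / (4 * N).
    by field; rewrite gt_eqF.
  rewrite ler_wpM2r ?invr_ge0 ?mulr_ge0 ?(ltW N0) // /A ler_pM ?expR_ge0 //.
    apply: mulr_ge0; last by rewrite subr_ge0 ch_ge1.
    by apply: mulr_ge0 => //; apply: mulr_ge0.
  by rewrite ler_expR; have := N0; lra.
have : A / (4 * N) * (E y - expR (8 * N)) <= Z y by [].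
have := ler_wpM2r (_ : 0 <= E y - expR (8 * N)) XA.
rewrite subr_ge0 => /(_ (ltW Eyb)).
have := S_ge0 0; rewrite /Z /E.
set u := H * (ch _ - 1); set v := A / _ * _; lra.
Qed.

End VerticalLine.

(** * Complex-valued functions of a real variable *)

Local Notation Re := complex.Re.
Local Notation Im := complex.Im.

Section ComplexDerivative.
Variable R : realType.
Implicit Types (z w : R -> R[i]) (t y : R) (a b : R[i]).

Lemma ReD a b : Re (a + b) = Re a + Re b. Proof. by case: a b => ? ? []. Qed.
Lemma ImD a b : Im (a + b) = Im a + Im b. Proof. by case: a b => ? ? []. Qed.
Lemma ReN a : Re (- a) = - Re a. Proof. by case: a. Qed.
Lemma ImN a : Im (- a) = - Im a. Proof. by case: a. Qed.
Lemma ReM a b : Re (a * b) = Re a * Re b - Im a * Im b.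
Proof. by case: a b => ? ? []. Qed.
Lemma ImM a b : Im (a * b) = Re a * Im b + Im a * Re b.
Proof. by case: a b => ? ? []. Qed.
Lemma ReV a : Re a^-1 = Re a / (Re a ^+ 2 + Im a ^+ 2).
Proof. by case: a. Qed.
Lemma ImV a : Im a^-1 = - (Im a / (Re a ^+ 2 + Im a ^+ 2)).
Proof. by case: a. Qed.
Definition ReImE := (ReD, ImD, ReN, ImN, ReM, ImM).

Lemma complex_ext a b : Re a = Re b -> Im a = Im b -> a = b.
Proof. by case: a b => ? ? [? ?] /= -> ->. Qed.

Definition sqmod a : R := Re a ^+ 2 + Im a ^+ 2.

Lemma sqmod_ge0 a : 0 <= sqmod a.
Proof. by rewrite addr_ge0 ?sqr_ge0. Qed.

Lemma sqmod_eq0 a : (sqmod a == 0) = (a == 0).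
Proof.
by case: a => x y; rewrite paddr_eq0 ?sqr_ge0 // !sqrf_eq0 eq_complex.
Qed.

Lemma sqmodM a b : sqmod (a * b) = sqmod a * sqmod b.
Proof. by rewrite /sqmod !ReImE; ring. Qed.

Lemma sqmod_prod (I : Type) (r : seq I) (F : I -> R[i]) :
  sqmod (\prod_(i <- r) F i) = \prod_(i <- r) sqmod (F i).
Proof.
elim: r => [|i r ih]; last by rewrite !big_cons sqmodM ih.
by rewrite !big_nil /sqmod expr1n expr0n addr0.
Qed.

(** Componentwise in the real parameter: along a vertical line no holomorphic derivative is
    required. *)
Definition cdrv z y a :=
  drv (fun t => Re (z t)) y (Re a) /\ drv (fun t => Im (z t)) y (Im a).

Lemma cdrv_eq z y a b : cdrv z y a -> a = b -> cdrv z y b.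
Proof. by move=> dz <-. Qed.

Lemma cdrvC a y : cdrv (fun=> a) y 0.
Proof. by split; exact: drvC. Qed.

Lemma cdrvD z w y a b : cdrv z y a -> cdrv w y b ->
  cdrv (fun t => z t + w t) y (a + b).
Proof.
move=> [z1 z2] [w1 w2]; split.
  by under eq_fun do rewrite ReD; rewrite ReD; exact: drvD.
by under eq_fun do rewrite ImD; rewrite ImD; exact: drvD.
Qed.

Lemma cdrvN z y a : cdrv z y a -> cdrv (fun t => - z t) y (- a).
Proof.
move=> [z1 z2]; split.
  by under eq_fun do rewrite ReN; rewrite ReN; exact: drvN.
by under eq_fun do rewrite ImN; rewrite ImN; exact: drvN.
Qed.

Lemma cdrvM z w y a b : cdrv z y a -> cdrv w y b ->
  cdrv (fun t => z t * w t) y (a * w y + z y * b).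
Proof.
move=> [z1 z2] [w1 w2]; split.
  under eq_fun do rewrite ReM.
  by auto_drv; rewrite /= !ReImE; ring.
under eq_fun do rewrite ImM.
by auto_drv; rewrite /= !ReImE; ring.
Qed.

Lemma cdrvV z y a : z y != 0 -> cdrv z y a ->
  cdrv (fun t => (z t)^-1) y (- a * (z y)^-1 * (z y)^-1).
Proof.
rewrite -sqmod_eq0 /sqmod => z0 [z1 z2]; split.
  under eq_fun do rewrite ReV.
  by auto_drv; rewrite /= ?ReImE ?ReV ?ImV //; field.
under eq_fun do rewrite ImV.
by auto_drv; rewrite /= ?ReImE ?ReV ?ImV //; field.
Qed.

Lemma cdrv_horner (p : {poly R[i]}) z y a : cdrv z y a ->
  cdrv (fun t => p.[z t]) y (p^`().[z y] * a).
Proof.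
move=> dz; elim/poly_ind: p => [|p k ih].
  under eq_fun do rewrite horner0.
  by rewrite deriv0 horner0 mul0r; exact: cdrvC.
under eq_fun do rewrite hornerMXaddC.
apply: cdrv_eq (cdrvD (cdrvM ih dz) (cdrvC k y)) _.
by rewrite derivMXaddC !hornerE; ring.
Qed.

End ComplexDerivative.

(** * A second-order equation with its power factor split off *)

Section SecondOrderSystem.
Variables (R : realType) (G K l Ph : R -> R[i]) (mu : R -> R).
Hypothesis dG : forall y, cdrv G y (K y - l y * G y).
Hypothesis dK : forall y, cdrv K y (Ph y * G y - l y * K y).
Hypothesis dmu : forall y, drv mu y (2 * Re (l y) * mu y).

(** Formally u = m G and u' = m K with m' = l m and |m|^2 = mu, so that u'' = Ph u and J + i I =
    conj(u) u'. Only mu enters, so the multivalued factor m is never constructed. *)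
Let S y := mu y * sqmod (G y).
Let T y := mu y * sqmod (K y).
Let J y := mu y * (Re (G y) * Re (K y) + Im (G y) * Im (K y)).
Let I y := mu y * (Re (G y) * Im (K y) - Im (G y) * Re (K y)).

Lemma drv_weighted_sqmod y : drv S y (2 * J y).
Proof.
have [dG1 dG2] := dG y; have dmuy := dmu y; rewrite /S /J /sqmod; auto_drv.
by rewrite /= !ReImE; ring.
Qed.

Lemma drv_weighted_re y : drv J y (T y + Re (Ph y) * S y).
Proof.
have [dG1 dG2] := dG y; have [dK1 dK2] := dK y; have dmuy := dmu y.
rewrite /S /T /J /sqmod; auto_drv.
by rewrite /= !ReImE; ring.
Qed.

Lemma drv_weighted_im y : drv I y (Im (Ph y) * S y).
Proof.
have [dG1 dG2] := dG y; have [dK1 dK2] := dK y; have dmuy := dmu y.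
rewrite /S /I /sqmod; auto_drv.
by rewrite /= !ReImE; ring.
Qed.

Lemma drv_weighted_sqmod' y : drv T y (2 * (Re (Ph y) * J y + Im (Ph y) * I y)).
Proof.
have [dK1 dK2] := dK y; have dmuy := dmu y.
rewrite /T /I /J /sqmod; auto_drv.
by rewrite /= !ReImE; ring.
Qed.

End SecondOrderSystem.

(* [l] is the logarithmic derivative of (1 - x)^r (1 + x)^s. *)
Lemma liouville_normal_form (F : fieldType) (r s n x q0 q1 q2 : F) :
  1 - x != 0 -> 1 + x != 0 ->
  (1 - x ^+ 2) * q2 + (2 * (s - r) - (2 * r + 2 * s + 1) * x) * q1
    + n * (n + 2 * r + 2 * s) * q0 = 0 ->
  let l := - r / (1 - x) + s / (1 + x) in
  x * (l * q0 + q1) + (x ^+ 2 - 1) *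
    ((- r / (1 - x) ^+ 2 - s / (1 + x) ^+ 2) * q0 + l * q1 + q2) =
  ((n + r + s) ^+ 2 + r * (1 - 2 * r) / (1 - x) + s * (1 - 2 * s) / (1 + x)) * q0
    - (x ^+ 2 - 1) * (l * (l * q0 + q1)).
Proof.
move=> x1 x2 ode l.
apply/eqP; rewrite -subr_eq0; apply/eqP; rewrite -[RHS]oppr0 -ode /l.
by field; rewrite x1 x2.
Qed.

(* The factors [e] come from the parametrization x = cos. *)
Lemma liouville_normal_form_cos (F : fieldType) (r s n e x q0 q1 q2 : F) :
  1 - x != 0 -> 1 + x != 0 -> e ^+ 2 = x ^+ 2 - 1 ->
  (1 - x ^+ 2) * q2 + (2 * (s - r) - (2 * r + 2 * s + 1) * x) * q1
    + n * (n + 2 * r + 2 * s) * q0 = 0 ->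
  let l := - r / (1 - x) + s / (1 + x) in
  x * (l * q0 + q1) +
    e * (e * (- r / (1 - x) ^+ 2 - s / (1 + x) ^+ 2) * q0 + l * (q1 * e) + q2 * e) =
  ((n + r + s) ^+ 2 + r * (1 - 2 * r) / (1 - x) + s * (1 - 2 * s) / (1 + x)) * q0
    - e * l * (e * (l * q0 + q1)).
Proof.
move=> x1 x2 e2 ode l.
transitivity (x * (l * q0 + q1) + e ^+ 2 *
    ((- r / (1 - x) ^+ 2 - s / (1 + x) ^+ 2) * q0 + l * q1 + q2)); first by ring.
rewrite [e * l * _](_ : _ = e ^+ 2 * (l * (l * q0 + q1))); last by ring.
by rewrite e2; exact: liouville_normal_form.
Qed.

(** * The Jacobi equation on the line through arccos c *)

Section JacobiVerticalLine.
Variables (R : realType) (n : nat) (z : 'I_n -> R) (r s c : R).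
Implicit Types y t w : R.
Hypotheses (hz : forall k, -1 <= z k <= 1) (hc : 0 <= c < 1).

Let Q : {poly R} := \prod_(k < n) ('X - (z k)%:P).
Hypothesis ode : (1 - 'X ^+ 2) * Q^`()^`()
  + ((2 * (s - r))%:P - (2 * r + 2 * s + 1)%:P * 'X) * Q^`()
  + (n%:R * (n%:R + 2 * r + 2 * s))%:P * Q = 0.

Let N : R := n%:R + r + s.
Let a := r * (1 - 2 * r).
Let b := s * (1 - 2 * s).

Let sn := Num.sqrt (1 - c ^+ 2).

Let sn2 : sn ^+ 2 = 1 - c ^+ 2.
Proof.
rewrite sqr_sqrtr // subr_ge0; have /andP[c0 /ltW c1] := hc.
by rewrite expr_le1.
Qed.

Let sn_ge0 : 0 <= sn. Proof. exact: sqrtr_ge0. Qed.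

Let sn_le1 : sn <= 1.
Proof. by rewrite -(@expr_le1 _ 2) // sn2 gerBl sqr_ge0. Qed.

(** With c = cos theta and [sn] = sin theta this is cos(theta + i y); [eta] is its derivative in
    y. *)
Let xi y : R[i] := Complex (c * ch y) (- (sn * sh y)).
Let eta y : R[i] := Complex (c * sh y) (- (sn * ch y)).

Let dch y : drv (fun t => ch t) y (sh y).
Proof. by apply: drv_eq (drv_ch (drv_id y)) _; rewrite mulr1. Qed.

Let dsh y : drv (fun t => sh t) y (ch y).
Proof. by apply: drv_eq (drv_sh (drv_id y)) _; rewrite mulr1. Qed.

Let dxi y : cdrv xi y (eta y).
Proof.
have d1 := dch y; have d2 := dsh y.
by split; rewrite /=; auto_drv; rewrite /=; ring.
Qed.

Let deta y : cdrv eta y (xi y).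
Proof.
have d1 := dch y; have d2 := dsh y.
by split; rewrite /=; auto_drv; rewrite /=; ring.
Qed.

(** A and B are cofactors expressing u - v through the relations sn^2 = 1 - c^2 and ch^2 = 1 + sh^2;
    once they are supplied, [ring] can check the identity. *)
Let elim_sn (A B u v y : R) :
  u - v = A * (sn ^+ 2 - (1 - c ^+ 2)) + B * (ch y ^+ 2 - (1 + sh y ^+ 2)) -> u = v.
Proof.
rewrite sn2 ch2_sh2 !subrr !mulr0 addr0 => /eqP.
by rewrite subr_eq0 => /eqP.
Qed.

Let eta2 y : eta y ^+ 2 = xi y ^+ 2 - 1.
Proof.
apply: complex_ext; rewrite !expr2 !ReImE /=; last by ring.
by apply: (@elim_sn (- (ch y ^+ 2 - sh y ^+ 2)) (-1) _ _ y); ring.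
Qed.

Let sqmod1B y : sqmod (1 - xi y) = (ch y - c) ^+ 2.
Proof.
rewrite /sqmod !ReImE /=.
by apply: (@elim_sn (sh y ^+ 2) (- (1 - c ^+ 2)) _ _ y); ring.
Qed.

Let sqmod1D y : sqmod (1 + xi y) = (ch y + c) ^+ 2.
Proof.
rewrite /sqmod !ReImE /=.
by apply: (@elim_sn (sh y ^+ 2) (- (1 - c ^+ 2)) _ _ y); ring.
Qed.

Let chBc y : 0 < ch y - c.
Proof. by have := ch_ge1 y; have /andP[] := hc; lra. Qed.

Let chDc y : 0 < ch y + c.
Proof. by have := ch_ge1 y; have /andP[] := hc; lra. Qed.

Let xiB y : 1 - xi y != 0.
Proof. by rewrite -sqmod_eq0 sqmod1B sqrf_eq0 gt_eqF. Qed.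

Let xiD y : 1 + xi y != 0.
Proof. by rewrite -sqmod_eq0 sqmod1D sqrf_eq0 gt_eqF. Qed.

Let C (x : R) : R[i] := x%:C%C.
Let ev (p : {poly R}) (x : R[i]) := (map_poly (real_complex R) p).[x].

Let evD p q x : ev (p + q) x = ev p x + ev q x.
Proof. by rewrite /ev rmorphD hornerD. Qed.
Let evN p x : ev (- p) x = - ev p x.
Proof. by rewrite /ev rmorphN hornerN. Qed.
Let evM p q x : ev (p * q) x = ev p x * ev q x.
Proof. by rewrite /ev rmorphM hornerM. Qed.
Let evC k x : ev k%:P x = C k.
Proof. by rewrite /ev map_polyC hornerC. Qed.
Let evX x : ev 'X x = x.
Proof. by rewrite /ev map_polyX hornerX. Qed.

Let dev p y : cdrv (fun t => ev p (xi t)) y (ev p^`() (xi y) * eta y).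
Proof.
by apply: cdrv_eq (cdrv_horner _ (dxi y)) _; rewrite /ev deriv_map.
Qed.

(** On the line, [lq] and [la] are the logarithmic derivatives of (1 - x)^r (1 + x)^s in x and in y,
    and [mu] is its squared modulus, by [sqmod1B] and [sqmod1D]. *)
Let lq x := - C r / (1 - x) + C s / (1 + x).
Let la y := eta y * lq (xi y).
Let G y := ev Q (xi y).
Let K y := eta y * (lq (xi y) * G y + ev Q^`() (xi y)).
Let Ph y := C N ^+ 2 + C a / (1 - xi y) + C b / (1 + xi y).
Let mu y := (ch y - c) `^ (2 * r) * (ch y + c) `^ (2 * s).

Let dlq y : cdrv (fun t => lq (xi t)) y
  (eta y * (- C r / (1 - xi y) ^+ 2 - C s / (1 + xi y) ^+ 2)).
Proof.
have d1 := cdrvV (xiB y) (cdrvD (cdrvC 1 y) (cdrvN (dxi y))).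
have d2 := cdrvV (xiD y) (cdrvD (cdrvC 1 y) (dxi y)).
apply: cdrv_eq (cdrvD (cdrvM (cdrvC (- C r) y) d1) (cdrvM (cdrvC (C s) y) d2)) _.
by rewrite /=; field; rewrite xiB xiD.
Qed.

Let dG y : cdrv G y (K y - la y * G y).
Proof. by apply: cdrv_eq (dev Q y) _; rewrite /K /la; ring. Qed.

Let odeC x : (1 - x ^+ 2) * ev Q^`()^`() x
  + (2 * (C s - C r) - (2 * C r + 2 * C s + 1) * x) * ev Q^`() x
  + n%:R * (n%:R + 2 * C r + 2 * C s) * ev Q x = 0.
Proof.
have := congr1 (fun p => ev p x) ode.
rewrite expr2 !(evD, evN, evM, evC, evX).
rewrite /C.
rewrite !(rmorphD, rmorphB, rmorphM, rmorph_nat, rmorph1, rmorph0) => h.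
by rewrite -[RHS]h; ring.
Qed.

Let dK y : cdrv K y (Ph y * G y - la y * K y).
Proof.
apply: cdrv_eq.
  exact: (cdrvM (deta y) (cdrvD (cdrvM (dlq y) (dev Q y)) (dev Q^`() y))).
have h := liouville_normal_form_cos (xiB y) (xiD y) (eta2 y) (odeC (xi y)).
have eN : C N = n%:R + C r + C s by rewrite /C /N !rmorphD rmorph_nat.
have ea : C a = C r * (1 - 2 * C r).
  by rewrite /C /a !(rmorphM, rmorphB, rmorph1, rmorph_nat).
have eb : C b = C s * (1 - 2 * C s).
  by rewrite /C /b !(rmorphM, rmorphB, rmorph1, rmorph_nat).
by apply: etrans h _; rewrite /Ph eN ea eb.
Qed.

Let Rew1 y : Re (1 - xi y)^-1 = (1 - c * ch y) / (ch y - c) ^+ 2.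
Proof. by rewrite ReV -/(sqmod _) sqmod1B ReD ReN. Qed.
Let Imw1 y : Im (1 - xi y)^-1 = - (sn * sh y) / (ch y - c) ^+ 2.
Proof. by rewrite ImV -/(sqmod _) sqmod1B ImD ImN /= add0r opprK mulNr. Qed.
Let Rew2 y : Re (1 + xi y)^-1 = (1 + c * ch y) / (ch y + c) ^+ 2.
Proof. by rewrite ReV -/(sqmod _) sqmod1D ReD. Qed.
Let Imw2 y : Im (1 + xi y)^-1 = sn * sh y / (ch y + c) ^+ 2.
Proof. by rewrite ImV -/(sqmod _) sqmod1D ImD /= add0r mulNr opprK. Qed.

Let ReC x : Re (C x) = x. Proof. by []. Qed.
Let ImC x : Im (C x) = 0. Proof. by []. Qed.

Let Rela y : Re (la y) = r * sh y / (ch y - c) + s * sh y / (ch y + c).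
Proof.
have B0 : ch y - c != 0 by rewrite gt_eqF.
have D0 : ch y + c != 0 by rewrite gt_eqF.
have -> : la y = - (eta y * C r / (1 - xi y)) + eta y * C s / (1 + xi y).
  by rewrite /la /lq; ring.
rewrite ReD ReN.
have -> : Re (eta y * C r / (1 - xi y)) = - (r * sh y / (ch y - c)).
  rewrite !ReM ImM ReC ImC Rew1 Imw1 /= !mulr0 !subr0 add0r.
  transitivity (r * sh y * (c - c ^+ 2 * ch y - sn ^+ 2 * ch y) / (ch y - c) ^+ 2).
    by field.
  by rewrite sn2; field.
have -> : Re (eta y * C s / (1 + xi y)) = s * sh y / (ch y + c).
  rewrite !ReM ImM ReC ImC Rew2 Imw2 /= !mulr0 !subr0 add0r.
  transitivity (s * sh y * (c + c ^+ 2 * ch y + sn ^+ 2 * ch y) / (ch y + c) ^+ 2).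
    by field.
  by rewrite sn2; field.
by rewrite opprK.
Qed.

Let RePh y : Re (Ph y) = N ^+ 2 + a * (1 - c * ch y) / (ch y - c) ^+ 2
  + b * (1 + c * ch y) / (ch y + c) ^+ 2.
Proof.
rewrite /Ph expr2 !ReImE ReC ImC Rew1 Rew2 !ReC !ImC.
by rewrite !mul0r !subr0 expr2 !mulrA.
Qed.

Let ImPh y : Im (Ph y) = sn * sh y * (b / (ch y + c) ^+ 2 - a / (ch y - c) ^+ 2).
Proof.
rewrite /Ph expr2 !ReImE ReC ImC Imw1 Imw2 !ReC !ImC.
by ring.
Qed.

Let dmu y : drv mu y (2 * Re (la y) * mu y).
Proof.
have d1 := dch y; rewrite Rela /mu; auto_drv; [exact: chBc|exact: chDc|].
have B0 : ch y - c != 0 by rewrite gt_eqF.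
have D0 : ch y + c != 0 by rewrite gt_eqF.
by rewrite /=; field; rewrite B0 D0.
Qed.

Definition line_S y := mu y * sqmod (G y).
Definition line_T y := mu y * sqmod (K y).
Definition line_J y := mu y * (Re (G y) * Re (K y) + Im (G y) * Im (K y)).
Definition line_I y := mu y * (Re (G y) * Im (K y) - Im (G y) * Re (K y)).

Let dS y : drv line_S y (2 * line_J y).
Proof. exact: (drv_weighted_sqmod dG dmu). Qed.
Let dJ y : drv line_J y (line_T y + Re (Ph y) * line_S y).
Proof. exact: (drv_weighted_re dG dK dmu). Qed.
Let dI y : drv line_I y (Im (Ph y) * line_S y).
Proof. exact: (drv_weighted_im dG dK dmu). Qed.
Let dT y : drv line_T y (2 * (Re (Ph y) * line_J y + Im (Ph y) * line_I y)).
Proof. exact: (drv_weighted_sqmod' dK dmu). Qed.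

Definition jweight (x : R) := (1 - x) `^ (2 * r) * (1 + x) `^ (2 * s).
(** The derivative of (1 - x)^r (1 + x)^s Q divided by (1 - x)^r (1 + x)^s; [jweight] is the square
    of that factor. *)
Definition jslope (x : R) := (- r / (1 - x) + s / (1 + x)) * Q.[x] + Q^`().[x].

Let mu0 : mu 0 = jweight c. Proof. by rewrite /mu ch0. Qed.
Let xi0 : xi 0 = C c.
Proof. by rewrite /xi ch0 sh0 mulr1 mulr0 oppr0. Qed.
Let eta0 : eta 0 = Complex 0 (- sn).
Proof. by rewrite /eta ch0 sh0 mulr1 mulr0. Qed.
Let evR p (x : R) : ev p (C x) = C p.[x].
Proof. by rewrite /ev horner_map. Qed.
Let G0 : G 0 = C Q.[c]. Proof. by rewrite /G xi0 evR. Qed.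
Let K0 : K 0 = Complex 0 (- sn * jslope c).
Proof.
have -> : K 0 = Complex 0 (- sn) * C (jslope c).
  rewrite /K eta0 xi0 G0 evR; congr (_ * _); rewrite /lq /jslope /C.
  by rewrite !(rmorphD, rmorphM, rmorphN, rmorph1, fmorphV).
by apply: complex_ext; rewrite ?ReM ?ImM ReC ImC /=; ring.
Qed.

Lemma line_S0 : line_S 0 = jweight c * Q.[c] ^+ 2.
Proof. by rewrite /line_S mu0 G0 /sqmod ReC ImC expr0n addr0. Qed.

Lemma line_T0 : line_T 0 = jweight c * (1 - c ^+ 2) * jslope c ^+ 2.
Proof.
rewrite /line_T mu0 K0 /sqmod /= -sn2; ring.
Qed.

Let J0 : line_J 0 = 0.
Proof. by rewrite /line_J G0 K0 ReC ImC /=; ring. Qed.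

Let I0 : line_I 0 = - (jweight c * (Q.[c] * (sn * jslope c))).
Proof. by rewrite /line_I mu0 G0 K0 ReC ImC /=; ring. Qed.

Let mu_ge0 y : 0 <= mu y.
Proof. by rewrite mulr_ge0 // powR_ge0. Qed.

Let S_ge0 y : 0 <= line_S y.
Proof. by rewrite mulr_ge0 // sqmod_ge0. Qed.

Let GE y : sqmod (G y) = \prod_(k < n) sqmod (xi y - C (z k)).
Proof.
rewrite /G /ev /Q rmorph_prod horner_prod sqmod_prod; apply: eq_bigr => k _.
by rewrite rmorphB /= map_polyX map_polyC hornerD hornerN hornerX hornerC.
Qed.

Let sqmod_xiB y w : sqmod (xi y - C w) =
  ch y ^+ 2 - 2 * c * w * ch y + w ^+ 2 + c ^+ 2 - 1.
Proof.
rewrite /sqmod !ReImE ReC ImC /=.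
by apply: (@elim_sn (sh y ^+ 2) (- (1 - c ^+ 2)) _ _ y); ring.
Qed.

Hypotheses (n1 : (0 < n)%N) (hr : 0 <= r <= 1 / 2) (hs : 0 <= s <= 1 / 2).

Let N1 : 1 <= N.
Proof.
have : (1 : R) <= n%:R by rewrite ler1n.
by rewrite /N; have /andP[] := hr; have /andP[] := hs; lra.
Qed.

Let powN2 (x : R) : 0 <= x -> x `^ (2 * r) * x `^ (2 * s) * (x ^+ 2) ^+ n = x `^ (2 * N).
Proof.
move=> x0; rewrite -exprM -powR_mulrn //.
have r0 : 0 <= r by case/andP: hr.
have s0 : 0 <= s by case/andP: hs.
have [->|x_neq0] := eqVneq x 0.
  rewrite (@powR0 _ (2 * n)%:R) ?pnatr_eq0 ?muln_eq0 -?lt0n // mulr0 powR0 //.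
  by rewrite mulf_neq0 // gt_eqF // (lt_le_trans _ N1).
rewrite -!powRD ?x_neq0 ?implybT //; congr (_ `^ _).
by rewrite /N natrM; ring.
Qed.

Lemma line_S_le y : line_S y <= (ch y + 1) `^ (2 * N).
Proof.
have y1 := ch_ge1 y.
have c1 : 0 <= ch y + 1 by lra.
have /andP[r0 _] := hr; have /andP[s0 _] := hs; have /andP[c0 /ltW c_le1] := hc.
rewrite -powN2 // /line_S /mu; apply: ler_pM.
- by rewrite mulr_ge0 // powR_ge0.
- exact: sqmod_ge0.
- apply: ler_pM; rewrite ?powR_ge0 //.
    by apply: ge0_ler_powR; rewrite ?nnegrE ?mulr_ge0 ?(ltW (chBc y)) //; lra.
  by apply: ge0_ler_powR; rewrite ?nnegrE ?mulr_ge0 ?(ltW (chDc y)) //; lra.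
- rewrite GE -[X in _ ^+ X]card_ord -prodr_const; apply: ler_prod => k _.
  rewrite sqmod_ge0 sqmod_xiB /=.
  have /andP[z1 z2] := hz k.
  have h1 : 0 <= ch y * (1 + c * z k).
    by rewrite mulr_ge0 ?(le_trans _ y1) //; nra.
  have h2 : 0 <= (1 - z k) * (1 + z k) by rewrite mulr_ge0 //; lra.
  have h3 : 0 <= (1 - c) * (1 + c) by rewrite mulr_ge0 //; lra.
  by lra.
Qed.

(** For the equality case, where Phi is constant and c = 0 is a permitted choice. There |xi - w|^2 =
    ch^2 + w^2 - 1 >= (ch - 1)^2, so the lower bound has the same leading growth as the upper
    one. *)
Lemma line_S_ge y : c = 0 -> (ch y - 1) `^ (2 * N) <= line_S y.
Proof.
move=> c_eq0; have y1 := ch_ge1 y.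
have c1 : 0 <= ch y - 1 by lra.
have /andP[r0 _] := hr; have /andP[s0 _] := hs.
rewrite -powN2 // /line_S /mu c_eq0 subr0 addr0; apply: ler_pM.
- by rewrite mulr_ge0 // powR_ge0.
- by rewrite exprn_ge0 // sqr_ge0.
- have c2 : 0 <= ch y by lra.
  have pw p : 0 <= p -> (ch y - 1) `^ p <= ch y `^ p.
    by move=> p0; apply: ge0_ler_powR => //; rewrite gerBl.
  by apply: ler_pM; rewrite ?powR_ge0 //; apply: pw; rewrite mulr_ge0.
- rewrite GE -[X in _ ^+ X]card_ord -prodr_const; apply: ler_prod => k _.
  rewrite sqr_ge0 sqmod_xiB /= c_eq0.
  by have := sqr_ge0 (z k); nra.
Qed.

Let H := (line_T 0 + N ^+ 2 * line_S 0) / (2 * N ^+ 2).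

Lemma jacobi_line_eq y : a = 0 -> b = 0 -> 0 <= y ->
  line_S y = line_S 0 + H * (ch (2 * N * y) - 1).
Proof.
move=> a0 b0; apply: (line_eq N1 dS dJ dT J0) => t.
  by rewrite RePh a0 b0; ring.
by rewrite ImPh a0 b0; ring.
Qed.

Hypothesis hab : a * (1 + c) ^+ 2 <= b * (1 - c) ^+ 2.

Let a_ge0 : 0 <= a.
Proof. by have /andP[? ?] := hr; rewrite /a mulr_ge0 //; lra. Qed.

Let b_ge0 : 0 <= b.
Proof. by have /andP[? ?] := hs; rewrite /b mulr_ge0 //; lra. Qed.

(** As c >= 0, the quotient (ch y + c) / (ch y - c) is largest at y = 0, where the claim is [hab].
    This inequality controls both the sign of Im Phi and the lower bound for Re Phi. *)
Let leAB y : a / (ch y - c) ^+ 2 <= b / (ch y + c) ^+ 2.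
Proof.
have /andP[c0 c1] := hc; have y1 := ch_ge1 y; have B0 := chBc y; have D0 := chDc y.
rewrite ler_pdivrMr ?exprn_gt0 // mulrAC ler_pdivlMr ?exprn_gt0 //.
have c1' : 0 < (1 - c) ^+ 2 by rewrite exprn_gt0 // subr_gt0.
rewrite -(ler_pM2r c1').
have h : ((ch y + c) * (1 - c)) ^+ 2 <= ((ch y - c) * (1 + c)) ^+ 2.
  apply: lerXn2r; rewrite ?nnegrE; last by nra.
  - by apply: mulr_ge0; [exact: ltW|rewrite subr_ge0 ltW].
  - by apply: mulr_ge0; [exact: ltW|rewrite addr_ge0].
have h1 := ler_wpM2l a_ge0 h.
have h2 := ler_wpM2l (sqr_ge0 (ch y - c)) hab.
by move: h1 h2; lra.
Qed.

(** Re Phi - N^2 is A (1 - c ch y) + B (1 + c ch y). The first term may be negative for large y, and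
    A <= B compensates for it. The upper bound supplies the Gronwall constant. *)
Let frB y : b / (ch y + c) ^+ 2 <= Re (Ph y) - N ^+ 2 <= 2 * b.
Proof.
have /andP[c0 c1] := hc; have y1 := ch_ge1 y; have D0 := chDc y.
pose A := a / (ch y - c) ^+ 2; pose B := b / (ch y + c) ^+ 2.
have AB : A <= B := leAB y.
have A0 : 0 <= A by apply: divr_ge0; rewrite ?sqr_ge0.
have hB : B * (1 + ch y) <= 2 * b.
  rewrite /B mulrAC ler_pdivrMr ?exprn_gt0 //.
  have : 1 + ch y <= 2 * (ch y + c) ^+ 2 by nra.
  by move=> /(ler_wpM2l b_ge0); lra.
have -> : Re (Ph y) - N ^+ 2 = A * (1 - c * ch y) + B * (1 + c * ch y).
  by rewrite RePh /A /B; ring.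
rewrite -/B; have B0 : 0 <= B by exact: le_trans AB.
clearbody A B.
have h0 : 0 <= c * ch y by rewrite mulr_ge0 // (le_trans _ y1).
have hch : c * ch y <= ch y by rewrite ler_piMl ?(ltW c1) // (le_trans _ y1).
move: h0 hch; set h := c * ch y => h0 hch.
have q1 := mulr_ge0 B0 h0.
have q2 : 0 <= B * (ch y - 1) by rewrite mulr_ge0 // subr_ge0.
have q3 : 0 <= B * (ch y - h) by rewrite mulr_ge0 // subr_ge0.
have [h1|/ltW h1] := leP h 1.
  have q4 : 0 <= A * (1 - h) by rewrite mulr_ge0 // subr_ge0.
  have q5 : 0 <= (B - A) * (1 - h) by rewrite mulr_ge0 // subr_ge0.
  by apply/andP; split; [|apply: le_trans hB]; lra.
have q4 : 0 <= A * (h - 1) by rewrite mulr_ge0 // subr_ge0.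
have q5 : 0 <= (B - A) * (h - 1) by rewrite mulr_ge0 // subr_ge0.
by apply/andP; split; [|apply: le_trans hB]; lra.
Qed.

Let frB0 y : 0 <= y -> 0 <= Re (Ph y) - N ^+ 2 <= 2 * b.
Proof.
move=> _; have /andP[h ->] := frB y; rewrite andbT; apply: le_trans h.
by apply: divr_ge0; rewrite ?sqr_ge0.
Qed.

Let fi0 y : 0 <= y -> 0 <= Im (Ph y).
Proof.
by move=> y0; rewrite ImPh mulr_ge0 ?subr_ge0 ?leAB // mulr_ge0 // sh_ge0.
Qed.

Let fifr y : 0 <= y -> Im (Ph y) <= (Re (Ph y) - N ^+ 2) * sh (2 * N * y).
Proof.
move=> y0; have /andP[hB _] := frB y; rewrite ImPh.
have sy : sh y <= sh (2 * N * y) by apply: sh_le; have := N1; nra.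
have s0 := sh_ge0 y0.
have B0 : 0 <= b / (ch y + c) ^+ 2 by apply: divr_ge0; rewrite ?sqr_ge0.
have A0 : 0 <= a / (ch y - c) ^+ 2 by apply: divr_ge0; rewrite ?sqr_ge0.
have p1 : 0 <= sn * sh y := mulr_ge0 sn_ge0 s0.
have p2 : 0 <= b / (ch y + c) ^+ 2 - a / (ch y - c) ^+ 2 by rewrite subr_ge0 leAB.
have p3 : sn * sh y <= sh (2 * N * y) by apply: le_trans sy; apply: ler_piMl.
have p4 : b / (ch y + c) ^+ 2 - a / (ch y - c) ^+ 2 <= Re (Ph y) - N ^+ 2.
  by apply: le_trans hB; rewrite gerBl.
by rewrite [leRHS]mulrC; exact: ler_pM.
Qed.

Let jw_ge0 : 0 <= jweight c.
Proof. by rewrite mulr_ge0 ?powR_ge0. Qed.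

Let T0_ge0 : 0 <= line_T 0.
Proof. by rewrite mulr_ge0 // sqmod_ge0. Qed.

(** Young's inequality |u u'| <= (u'^2 + N^2 u^2) / (2 N) at the base point. *)
Let I0_ge : - (N * H) <= line_I 0.
Proof.
have N0 : 0 < N := lt_le_trans ltr01 N1.
have -> : N * H = (line_T 0 + N ^+ 2 * line_S 0) / (2 * N).
  by rewrite /H; field; rewrite gt_eqF.
rewrite I0 lerN2 ler_pdivlMr ?mulr_gt0 // line_T0 line_S0 -sn2.
have := mulr_ge0 jw_ge0 (sqr_ge0 (N * Q.[c] - sn * jslope c)); lra.
Qed.

Lemma jacobi_line_ge y : 2 <= y ->
  H * (ch (2 * N * y) - 1) +
  b / (ch 2 + 1) ^+ 2 * (ch (2 * N) - 1) / (2 * N) * expR (- (8 * N)) * H *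
     (expR (2 * N * y) - expR (8 * N)) <= line_S y.
Proof.
apply: (line_ge_strict N1 dS dJ dI dT J0 frB0 fi0 fifr S_ge0 T0_ge0 I0_ge).
  (* Since c < 1 and t <= 2, the lower bound b / (ch t + c)^2 is replaced by one that is free of
     c. *)
  move=> t /andP[t1 t2]; have /andP[h _] := frB t; apply: le_trans h.
  have /andP[c0 /ltW c1] := hc.
  have p1 : 0 < (ch 2 + 1 : R) ^+ 2 by rewrite exprn_gt0 // addr_gt0 ?ch_gt0.
  have p2 : 0 < (ch t + c) ^+ 2 by rewrite exprn_gt0 ?chDc.
  apply: ler_wpM2l => //; rewrite lef_pV2 ?posrE //.
  have ht : ch t <= ch 2 by rewrite ch_le // (le_trans _ t1).
  apply: lerXn2r; rewrite ?nnegrE ?(ltW (chDc t)) //; last by lra.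
  by have := ch_gt0 (2 : R); lra.
by apply: divr_ge0; rewrite ?sqr_ge0.
Qed.

End JacobiVerticalLine.

(** * Comparison of leading coefficients as y tends to infinity *)

Section Asymptotics.
Variables (R : realType) (N : R).
Hypothesis N1 : 1 <= N.

Let N2 : 0 < 2 * N. Proof. by have := N1; lra. Qed.

Let ch_ln (t : R) : 0 < t -> ch (- ln t) = (t^-1 + t) / 2.
Proof. by move=> t0; rewrite chE opprK expRN !lnK. Qed.

Let expR_ln (t : R) : 0 < t -> expR (2 * N * - ln t) * t `^ (2 * N) = 1.
Proof.
move=> t0; rewrite -{2}[t]lnK // -expRM -expRD.
by rewrite -[RHS]expR0; congr expR; ring.
Qed.

Let chD1 (t : R) : 0 < t ->
  (ch (- ln t) + 1) `^ (2 * N) * t `^ (2 * N) = ((1 + t) ^+ 2 / 2) `^ (2 * N).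
Proof.
move=> t0; rewrite -powRM ?ltW //; last by rewrite addr_gt0 // ch_gt0.
by congr (_ `^ _); rewrite ch_ln //; field; rewrite gt_eqF.
Qed.

Let chB1 (t : R) : 0 < t ->
  (ch (- ln t) - 1) `^ (2 * N) * t `^ (2 * N) = ((1 - t) ^+ 2 / 2) `^ (2 * N).
Proof.
move=> t0; rewrite -powRM ?(ltW t0) ?subr_ge0 ?ch_ge1 //.
by congr (_ `^ _); rewrite ch_ln //; field; rewrite gt_eqF.
Qed.

Let half : (1 / 2 : R) `^ (2 * N) = 2 `^ (- (2 * N)).
Proof. by rewrite powRN div1r -powR_inv1 // -powRrM mulN1r powRN. Qed.

Let ln_ge2 (t : R) : 0 < t -> t < expR (- 2) -> 2 <= - ln t.
Proof.
by move=> t0 /ltW; rewrite -{1}[t]lnK // ler_expR lerNr.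
Qed.

(** Put y = - ln t and multiply by t^(2 N) = e^(- 2 N y). The right side becomes ((1 + t)^2 / 2)^(2
    N), which is continuous at t = 0, so the limit is an ordinary one at 0+. *)
Lemma exp_growth_le (H k e : R) : 0 <= H -> 0 <= k -> 0 <= e ->
  (forall y, 2 <= y ->
    H * (ch (2 * N * y) - 1) + k * H * (expR (2 * N * y) - e)
      <= (ch y + 1) `^ (2 * N)) ->
  H * (1 / 2 + k) <= 2 `^ (- (2 * N)).
Proof.
move=> H0 k0 e0 hyp.
pose f (t : R) := ((1 + t) ^+ 2 / 2) `^ (2 * N).
have cf : f t @[t --> (0 : R)^'+] --> f 0.
  apply: cvg_at_right_filter; apply: drv_continuous.
  by rewrite /f; auto_drv; [rewrite addr0 expr1n divr_gt0|].
have cg : H * (1 + k * e) * t `^ (2 * N) @[t --> (0 : R)^'+] --> H * (1 + k * e) * 0.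
  by apply: cvgM; [exact: cvg_cst|exact: powR_cvg0].
have f0 : f 0 = 2 `^ (- (2 * N)) by rewrite /f addr0 expr1n half.
have cfg : f t + H * (1 + k * e) * t `^ (2 * N) @[t --> (0 : R)^'+] -->
    2 `^ (- (2 * N)).
  have <- : f 0 + H * (1 + k * e) * 0 = 2 `^ (- (2 * N)) by rewrite f0 mulr0 addr0.
  exact: cvgD cf cg.
apply: cvgr_to_ge cfg _.
near=> t.
have t0 : 0 < t by near: t; exact: nbhs_right_gt.
have t1 : t < expR (- 2) by near: t; apply: nbhs_right_lt; exact: expR_gt0.
have p0 : 0 < t `^ (2 * N) by rewrite powR_gt0.
have := ler_wpM2r (ltW p0) (hyp _ (ln_ge2 t0 t1)).
rewrite (chD1 t0) -/(f t) /= => h.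
have E := expR_ln t0.
have hc := ch_ge_expR (2 * N * - ln t).
have h1 := ler_wpM2l H0 (ler_wpM2r (ltW p0) hc).
move: h h1; rewrite /=.
move: E; set u := expR _; set v := ch _; set p := t `^ _ => E h h1.
have -> : H * (1 / 2 + k) = H * (u / 2 * p) + k * H * (u * p).
  by rewrite [u / 2 * p]mulrAC E; field.
lra.
Unshelve. all: by end_near. Qed.

Lemma exp_growth_ge (H S0 : R) : 0 <= H ->
  (forall y, 0 <= y ->
    (ch y - 1) `^ (2 * N) <= S0 + H * (ch (2 * N * y) - 1)) ->
  2 `^ (- (2 * N)) <= H / 2.
Proof.
move=> H0 hyp.
pose f (t : R) := ((1 - t) ^+ 2 / 2) `^ (2 * N).
have cf : f t @[t --> (0 : R)^'+] --> f 0.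
  apply: cvg_at_right_filter; apply: drv_continuous.
  by rewrite /f; auto_drv; [rewrite subr0 expr1n divr_gt0|].
have cg : S0 * t `^ (2 * N) @[t --> (0 : R)^'+] --> S0 * 0.
  by apply: cvgM; [exact: cvg_cst|exact: powR_cvg0].
have f0 : f 0 = 2 `^ (- (2 * N)) by rewrite /f subr0 expr1n half.
have cfg : f t - S0 * t `^ (2 * N) @[t --> (0 : R)^'+] --> 2 `^ (- (2 * N)).
  have <- : f 0 - S0 * 0 = 2 `^ (- (2 * N)) by rewrite f0 mulr0 subr0.
  exact: cvgB cf cg.
apply: cvgr_to_le cfg _.
near=> t.
have t0 : 0 < t by near: t; exact: nbhs_right_gt.
have t1 : t < expR (- 2) by near: t; apply: nbhs_right_lt; exact: expR_gt0.
have y2 := ln_ge2 t0 t1.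
have y0 : 0 <= - ln t by apply: le_trans y2.
have p0 : 0 < t `^ (2 * N) by rewrite powR_gt0.
have := ler_wpM2r (ltW p0) (hyp _ y0).
rewrite (chB1 t0) -/(f t) /= => h.
have E := expR_ln t0.
have hc : ch (2 * N * - ln t) - 1 <= expR (2 * N * - ln t) / 2.
  have : expR (- (2 * N * - ln t)) <= 1.
    by rewrite -[leRHS]expR0 ler_expR oppr_le0 mulr_ge0 // ltW.
  by rewrite chE; lra.
have h1 := ler_wpM2l H0 (ler_wpM2r (ltW p0) hc).
move: h h1; rewrite /=.
move: E; set u := expR _; set v := ch _; set p := t `^ _ => E h h1.
have e1 : H * (u / 2 * p) = H / 2 by rewrite mulrAC E; ring.
lra.
Unshelve. all: by end_near. Qed.

End Asymptotics.

(** * Sonin's function on the interval and the bound for the square *)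

Section SoninFunction.
Variables (R : realType) (n : nat) (z : 'I_n -> R) (r s : R).
Implicit Types x t c : R.

Let Q : {poly R} := \prod_(k < n) ('X - (z k)%:P).
Hypothesis ode : (1 - 'X ^+ 2) * Q^`()^`()
  + ((2 * (s - r))%:P - (2 * r + 2 * s + 1)%:P * 'X) * Q^`()
  + (n%:R * (n%:R + 2 * r + 2 * s))%:P * Q = 0.
Hypotheses (hz : forall k, -1 <= z k <= 1) (n1 : (0 < n)%N)
  (hr : 0 <= r <= 1 / 2) (hs : 0 <= s <= 1 / 2).

Let N : R := n%:R + r + s.
Let a := r * (1 - 2 * r).
Let b := s * (1 - 2 * s).
Let l x := - r / (1 - x) + s / (1 + x).
Let W := jweight r s.
Let k := jslope z r s.

Let a_ge0 : 0 <= a.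
Proof. by have /andP[? ?] := hr; rewrite /a mulr_ge0 //; lra. Qed.

Let b_ge0 : 0 <= b.
Proof. by have /andP[? ?] := hs; rewrite /b mulr_ge0 //; lra. Qed.

Let N1 : 1 <= N.
Proof.
have : (1 : R) <= n%:R by rewrite ler1n.
by rewrite /N; have /andP[] := hr; have /andP[] := hs; lra.
Qed.

Let N20 : 0 < N ^+ 2. Proof. by rewrite exprn_gt0 // (lt_le_trans _ N1). Qed.

Definition sonin_Phi x := N ^+ 2 + a / (1 - x) + b / (1 + x).
(** In the variable theta this is u^2 + u'^2 / Phi; the factor 1 - x^2 = sin^2 theta comes from dx =
    - sin theta dtheta. *)
Definition sonin_E x := W x * (Q.[x] ^+ 2 + (1 - x ^+ 2) * k x ^+ 2 / sonin_Phi x).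

Let Phi' x := a / (1 - x) ^+ 2 - b / (1 + x) ^+ 2.

Let W_ge0 x : 0 <= W x.
Proof. by rewrite /W /jweight mulr_ge0 ?powR_ge0. Qed.

Let xB x : -1 < x < 1 -> 0 < 1 - x.
Proof. by move=> /andP[? ?]; lra. Qed.

Let xD x : -1 < x < 1 -> 0 < 1 + x.
Proof. by move=> /andP[? ?]; lra. Qed.

Let x2 x : -1 < x < 1 -> 0 < 1 - x ^+ 2.
Proof.
move=> hx; have -> : 1 - x ^+ 2 = (1 - x) * (1 + x) by ring.
by rewrite mulr_gt0 ?xB ?xD.
Qed.

Lemma sonin_Phi_ge x : -1 < x < 1 -> N ^+ 2 <= sonin_Phi x.
Proof.
move=> hx; rewrite /sonin_Phi -addrA lerDl.
by apply: addr_ge0; apply: divr_ge0 => //; rewrite ltW ?xB ?xD.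
Qed.

Let Phi_gt0 x : -1 < x < 1 -> 0 < sonin_Phi x.
Proof. by move=> /sonin_Phi_ge; apply: lt_le_trans. Qed.

Lemma drv_jweight x : -1 < x < 1 -> drv W x (2 * l x * W x).
Proof.
move=> hx; rewrite /W /jweight; auto_drv; [exact: xB|exact: xD|].
by rewrite /= /l; field; rewrite !gt_eqF ?xB ?xD.
Qed.

Lemma drv_jpoly x : drv (fun t => Q.[t]) x (k x - l x * Q.[x]).
Proof.
by apply: drv_eq (drv_horner Q (drv_id x)) _; rewrite /k /jslope /l -/Q; ring.
Qed.

Lemma drv_jslope x : -1 < x < 1 ->
  drv k x ((x * k x - sonin_Phi x * Q.[x]) / (1 - x ^+ 2) - l x * k x).
Proof.
move=> hx.
have B0 : 1 - x != 0 by rewrite gt_eqF ?xB.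
have D0 : 1 + x != 0 by rewrite gt_eqF ?xD.
have X0 : 1 - x ^+ 2 != 0 by rewrite gt_eqF ?x2.
have odex : (1 - x ^+ 2) * Q^`()^`().[x]
    + (2 * (s - r) - (2 * r + 2 * s + 1) * x) * Q^`().[x]
    + n%:R * (n%:R + 2 * r + 2 * s) * Q.[x] = 0.
  by have := congr1 (fun p => p.[x]) ode; rewrite !hornerE.
have h := liouville_normal_form B0 D0 odex.
have -> : (x * k x - sonin_Phi x * Q.[x]) / (1 - x ^+ 2) - l x * k x =
    (- r / (1 - x) ^+ 2 - s / (1 + x) ^+ 2) * Q.[x] + l x * Q^`().[x] + Q^`()^`().[x].
  have {h} : x * k x + (x ^+ 2 - 1) *
    ((- r / (1 - x) ^+ 2 - s / (1 + x) ^+ 2) * Q.[x] + l x * Q^`().[x] + Q^`()^`().[x])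
    = sonin_Phi x * Q.[x] - (x ^+ 2 - 1) * (l x * k x) by exact: h.
  move: (_ + _ + Q^`()^`().[x]) => K h.
  have -> : sonin_Phi x * Q.[x] = x * k x + (x ^+ 2 - 1) * K + (x ^+ 2 - 1) * (l x * k x).
    by rewrite h subrK.
  by field.
rewrite /k /jslope -/Q; auto_drv => //.
by rewrite /= /l; field; rewrite B0 D0.
Qed.

(** Everything cancels except the derivative of 1 / Phi, so E moves opposite to Phi. *)
Lemma drv_sonin_E x : -1 < x < 1 ->
  drv sonin_E x (- (W x * (1 - x ^+ 2) * k x ^+ 2 * Phi' x / sonin_Phi x ^+ 2)).
Proof.
move=> hx.
have B0 : 1 - x != 0 by rewrite gt_eqF ?xB.
have D0 : 1 + x != 0 by rewrite gt_eqF ?xD.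
have X0 : 1 - x ^+ 2 != 0 by rewrite gt_eqF ?x2.
have P0 : sonin_Phi x != 0 by rewrite gt_eqF ?Phi_gt0.
have dW : drv (fun t => W t) x _ := drv_jweight hx.
have dQ := drv_jpoly x.
have dk : drv (fun t => k t) x _ := drv_jslope hx.
have dP : drv (fun t => sonin_Phi t) x (Phi' x).
  rewrite /sonin_Phi /Phi'; auto_drv => //.
  by rewrite /=; field; rewrite B0 D0.
apply: drv_eq (drvM dW (drvD (drvX 2 dQ) (drvM (drvM (drvD (drvC 1 x)
  (drvN (drvX 2 (drv_id x)))) (drvX 2 dk)) (drvV P0 dP)))) _.
by rewrite /=; field; rewrite P0 X0.
Qed.

Let E_le u v : -1 < u -> u <= v -> v < 1 ->
  (forall t, u <= t <= v -> Phi' t <= 0) -> sonin_E u <= sonin_E v.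
Proof.
move=> u1 uv v1 hP.
have huv t : u <= t <= v -> -1 < t < 1.
  by move=> /andP[ut tv]; rewrite (lt_le_trans u1 ut) (le_lt_trans tv v1).
apply: (@drv_nondecreasing _ sonin_E _ u v uv (fun t ht => drv_sonin_E (huv t ht))).
move=> t ht; rewrite oppr_ge0 mulrAC mulr_ge0_le0 ?hP //.
rewrite mulr_ge0 ?invr_ge0 ?sqr_ge0 // mulr_ge0 ?sqr_ge0 // mulr_ge0 //.
by rewrite ltW // x2 // huv.
Qed.

Let E_ge u v : -1 < u -> u <= v -> v < 1 ->
  (forall t, u <= t <= v -> 0 <= Phi' t) -> sonin_E v <= sonin_E u.
Proof.
move=> u1 uv v1 hP.
have huv t : u <= t <= v -> -1 < t < 1.
  by move=> /andP[ut tv]; rewrite (lt_le_trans u1 ut) (le_lt_trans tv v1).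
apply: (@drv_nonincreasing _ sonin_E _ u v uv (fun t ht => drv_sonin_E (huv t ht))).
move=> t ht; rewrite oppr_le0 mulrAC mulr_ge0 ?hP //.
rewrite mulr_ge0 ?invr_ge0 ?sqr_ge0 // mulr_ge0 ?sqr_ge0 // mulr_ge0 //.
by rewrite ltW // x2 // huv.
Qed.

Let Phi'_le0 x : -1 < x < 1 -> a * (1 + x) ^+ 2 <= b * (1 - x) ^+ 2 -> Phi' x <= 0.
Proof.
move=> hx h; rewrite /Phi' subr_le0 ler_pdivrMr ?exprn_gt0 ?xB //.
by rewrite mulrAC ler_pdivlMr ?exprn_gt0 ?xD.
Qed.

Let Phi'_ge0 x : -1 < x < 1 -> b * (1 - x) ^+ 2 <= a * (1 + x) ^+ 2 -> 0 <= Phi' x.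
Proof.
move=> hx h; rewrite /Phi' subr_ge0 ler_pdivrMr ?exprn_gt0 ?xD //.
by rewrite mulrAC ler_pdivlMr ?exprn_gt0 ?xB.
Qed.

(* Phi has its minimum at c = (sqrt b - sqrt a) / (sqrt b + sqrt a), where E
   is therefore maximal; this point is 1 when a = 0. *)
Lemma sonin_E_le_max x : -1 < x < 1 -> a <= b ->
  exists c, [/\ 0 <= c < 1, a * (1 + c) ^+ 2 <= b * (1 - c) ^+ 2 &
    sonin_E x <= sonin_E c].
Proof.
move=> hx ab; have /andP[x_gt x_lt] := hx.
have [a0|a_neq0] := eqVneq a 0.
  (* If a = 0, Phi is nonincreasing on the whole interval and E nondecreasing, so any c in [x, 1[
     serves; the maximum with 0 ensures 0 <= c. *)
  exists (Num.max x 0); split.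
  - by rewrite le_max lexx orbT gt_max x_lt ltr01.
  - by rewrite a0 mul0r mulr_ge0 // sqr_ge0.
  - apply: E_le; rewrite ?le_max ?lexx ?gt_max ?x_lt ?ltr01 // => t /andP[xt tc].
    apply: Phi'_le0; last by rewrite a0 mul0r mulr_ge0 // sqr_ge0.
    rewrite (lt_le_trans x_gt xt) /=; apply: le_lt_trans tc _.
    by rewrite gt_max x_lt ltr01.
have a_gt0 : 0 < a by rewrite lt_neqAle eq_sym a_neq0.
have b_gt0 : 0 < b := lt_le_trans a_gt0 ab.
pose u := Num.sqrt a; pose v := Num.sqrt b.
have u0 : 0 < u by rewrite sqrtr_gt0.
have v0 : 0 < v by rewrite sqrtr_gt0.
have uv : u <= v by rewrite ler_sqrt.
have u2 : u ^+ 2 = a by rewrite sqr_sqrtr.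
have v2 : v ^+ 2 = b by rewrite sqr_sqrtr.
have uv0 : 0 < v + u by rewrite addr_gt0.
have uv_neq0 : v + u != 0 by rewrite gt_eqF.
pose c := (v - u) / (v + u).
have c0 : 0 <= c by rewrite divr_ge0 ?subr_ge0 // ltW.
have c1 : c < 1 by rewrite ltr_pdivrMr // mul1r; lra.
have hc : a * (1 + c) ^+ 2 = b * (1 - c) ^+ 2.
  by rewrite -u2 -v2 /c; field.
have c0' : -1 < c by apply: lt_le_trans c0; rewrite oppr_lt0.
exists c; split; rewrite ?c0 ?c1 ?hc //.
have sq_le (p q : R) : 0 <= p -> p <= q -> p ^+ 2 <= q ^+ 2.
  by move=> p0 pq; apply: lerXn2r; rewrite ?nnegrE // (le_trans p0).
have [xc|/ltW cx] := leP x c.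
  apply: E_le => // t /andP[xt tc].
  have t1 : -1 < t := lt_le_trans x_gt xt.
  apply: Phi'_le0; first by rewrite t1 (le_lt_trans tc).
  apply: (@le_trans _ _ (a * (1 + c) ^+ 2)).
    by apply: ler_wpM2l => //; apply: sq_le; lra.
  by rewrite hc; apply: ler_wpM2l => //; apply: sq_le; lra.
apply: E_ge => // t /andP[ct tx].
have t1 : t < 1 := le_lt_trans tx x_lt.
apply: Phi'_ge0; first by rewrite t1 (lt_le_trans c0').
apply: (@le_trans _ _ (a * (1 + c) ^+ 2)).
  by rewrite hc; apply: ler_wpM2l => //; apply: sq_le; lra.
by apply: ler_wpM2l => //; apply: sq_le; lra.
Qed.

(** The extra coefficient of [jacobi_line_ge]. It is free of c, which depends on x, so the
    improvement is uniform in x. *)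
Definition jacobi_gain : R :=
  b / (ch 2 + 1) ^+ 2 * (ch (2 * N) - 1) / (2 * N) * expR (- (8 * N)).

Let N_gt0 : 0 < N. Proof. exact: lt_le_trans N1. Qed.

Lemma jacobi_gain_ge0 : 0 <= jacobi_gain.
Proof.
rewrite /jacobi_gain mulr_ge0 ?expR_ge0 //; apply: divr_ge0; last first.
  by rewrite mulr_ge0 // ltW.
apply: mulr_ge0; last by rewrite subr_ge0 ch_ge1.
by apply: divr_ge0; rewrite ?sqr_ge0.
Qed.

Lemma jacobi_gain_gt0 : 0 < b -> 0 < jacobi_gain.
Proof.
move=> b0; rewrite /jacobi_gain mulr_gt0 ?expR_gt0 //; apply: divr_gt0; last first.
  by rewrite mulr_gt0.
apply: mulr_gt0; last by rewrite subr_gt0 ch_gt1 // mulr_gt0.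
by apply: divr_gt0; rewrite ?exprn_gt0 ?addr_gt0 ?ch_gt0.
Qed.

Let H c := (line_T z r s c 0 + N ^+ 2 * line_S z r s c 0) / (2 * N ^+ 2).

Let HE c : 0 <= c < 1 ->
  2 * H c = W c * (Q.[c] ^+ 2 + (1 - c ^+ 2) * k c ^+ 2 / N ^+ 2).
Proof.
move=> hc; rewrite /H line_S0 line_T0 // -/W -/Q -/k.
by field; rewrite gt_eqF.
Qed.

Let H_ge0 c : 0 <= c < 1 -> 0 <= H c.
Proof.
move=> hc; have /andP[c0 c1] := hc.
have c2 : 0 < 1 - c ^+ 2 by rewrite x2 // c1 andbT (lt_le_trans _ c0) // oppr_lt0.
suff : 0 <= 2 * H c by rewrite pmulr_rge0.
rewrite HE // mulr_ge0 // addr_ge0 ?sqr_ge0 //.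
by apply: divr_ge0; rewrite ?sqr_ge0 // mulr_ge0 ?sqr_ge0 // ltW.
Qed.

Let H_le c : 0 <= c < 1 -> a * (1 + c) ^+ 2 <= b * (1 - c) ^+ 2 ->
  H c * (1 / 2 + jacobi_gain) <= 2 `^ (- (2 * N)).
Proof.
move=> hc hab.
apply: (exp_growth_le N1 (H_ge0 hc) jacobi_gain_ge0 (expR_ge0 (8 * N))) => y y2.
apply: le_trans (line_S_le hz hc n1 hr hs y).
exact: (jacobi_line_ge hc ode n1 hr hs hab y2).
Qed.

(** The chain is W Q^2 <= E(x) <= E(c) <= 2 H(c), the last step by Phi >= N^2. The right side is
    4^(1 - N), the square of the bound in the theorem. *)
Lemma jacobi_sqr_le x : -1 < x < 1 -> a <= b ->
  W x * Q.[x] ^+ 2 * (1 + 2 * jacobi_gain) <= 4 * 2 `^ (- (2 * N)).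
Proof.
move=> hx ab; have [c [hc hab Exc]] := sonin_E_le_max hx ab.
have c1 : -1 < c < 1.
  by have /andP[c0 ->] := hc; rewrite andbT (lt_le_trans _ c0) // oppr_lt0.
have h1 : W x * Q.[x] ^+ 2 <= sonin_E x.
  rewrite /sonin_E ler_wpM2l // lerDl; apply: divr_ge0; last exact: ltW (Phi_gt0 hx).
  by rewrite mulr_ge0 ?sqr_ge0 // ltW // x2.
have h2 : sonin_E c <= 2 * H c.
  rewrite HE // /sonin_E ler_wpM2l // lerD2l ler_wpM2l //.
    by rewrite mulr_ge0 ?sqr_ge0 // ltW // x2.
  by rewrite lef_pV2 ?posrE ?Phi_gt0 // sonin_Phi_ge.
have h3 : W x * Q.[x] ^+ 2 <= 2 * H c by apply: le_trans h1 (le_trans Exc h2).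
have g0 : 0 <= 1 + 2 * jacobi_gain by rewrite addr_ge0 // mulr_ge0 // jacobi_gain_ge0.
have := ler_wpM2r g0 h3; have := H_le hc hab; lra.
Qed.

(** Phi is constant here, hence so is E, which equals its value 2 H 0 at x = 0. The gain vanishes,
    and growth estimates from both sides on the line over 0 determine H 0. *)
Lemma jacobi_sonin_const x : -1 < x < 1 -> a = 0 -> b = 0 ->
  W x * (Q.[x] ^+ 2 + (1 - x ^+ 2) * k x ^+ 2 / N ^+ 2) = 4 * 2 `^ (- (2 * N)).
Proof.
move=> hx a0 b0.
have h00 := introT andP (conj (lexx (0 : R)) (ltr01 : (0 : R) < 1)).
have EE t : W t * (Q.[t] ^+ 2 + (1 - t ^+ 2) * k t ^+ 2 / N ^+ 2) = sonin_E t.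
  by rewrite /sonin_E /sonin_Phi a0 b0 !mul0r !addr0.
have P0 t : Phi' t = 0 by rewrite /Phi' a0 b0 !mul0r subrr.
have -> : W x * (Q.[x] ^+ 2 + (1 - x ^+ 2) * k x ^+ 2 / N ^+ 2) = 2 * H 0.
  rewrite HE // !EE; have /andP[x_gt x_lt] := hx.
  have m1 : -1 < 0 :> R by rewrite oppr_lt0.
  have [x0|/ltW x0] := leP x 0; apply/eqP; rewrite eq_le; apply/andP; split;
    by [apply: E_le => // t _; rewrite P0|apply: E_ge => // t _; rewrite P0].
have hab : a * (1 + 0) ^+ 2 <= b * (1 - 0) ^+ 2 by rewrite a0 b0 !mul0r.
have := H_le h00 hab.
have : 2 `^ (- (2 * N)) <= H 0 / 2.
  apply: (exp_growth_ge (S0 := line_S z r s 0 0) N1 (H_ge0 h00)) => y y0.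
  have hS := line_S_ge z h00 n1 hr hs y erefl.
  have hE := jacobi_line_eq h00 ode n1 hr hs a0 b0 y0.
  by rewrite hE in hS; exact: hS.
have -> : jacobi_gain = 0 by rewrite /jacobi_gain b0 !mul0r.
by move=> h1 h2; apply/eqP; rewrite eq_le; apply/andP; split; lra.
Qed.

End SoninFunction.

(** * The fundamental theorem of calculus with singular endpoints *)

Definition endpoint_gap (R : realType) (n : nat) : R := harmonic n / 2.

Section ImproperFTC.
Variable R : realType.
Local Notation mu := (@lebesgue_measure R).
Local Notation I := (`[-1, 1]%classic : set R).
Local Notation e := (@endpoint_gap R).

Let e_gt0 n : 0 < e n. Proof. by rewrite /endpoint_gap divr_gt0 // harmonic_gt0. Qed.

Let e_le n : e n <= 1 / 2.
Proof. by rewrite /endpoint_gap ler_wpM2r // invf_le1 // ler1n. Qed.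

Let cvg_e : e @ \oo --> 0.
Proof.
rewrite -[X in _ --> X](mul0r 2^-1).
by apply: cvgM; [exact: cvg_harmonic|exact: cvg_cst].
Qed.

Let F_ n : set R := `[-1 + e n, 1 - e n]%classic.

Let bigcup_F : \bigcup_n F_ n = `]-1, 1[%classic.
Proof.
apply/seteqP; split => x.
  move=> [n _]; rewrite /F_ /= !in_itv /= => /andP[h1 h2].
  by have e0 := e_gt0 n; apply/andP; split; lra.
rewrite /= in_itv /= => /andP[h1 h2].
have hd : 0 < Num.min (1 - x) (1 + x) by rewrite lt_min; apply/andP; split; lra.
have [n _ hn] := near_infty_natSinv_lt (PosNum hd).
exists n => //; rewrite /F_ /= in_itv /=.
have := hn n (leqnn n); rewrite /= lt_min => /andP[h3 h4].
have h5 : e n < n.+1%:R^-1.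
  by rewrite /endpoint_gap /= ltr_pdivrMr // ltr_pMr ?invr_gt0 // ltr1n.
move: h3 h4 h5; move: (e n) (n.+1%:R^-1 : R) => en t h3 h4 h5.
by apply/andP; split; lra.
Qed.

(** Monotone convergence over [-1 + e n, 1 - e n] replaces regularity of f at the endpoints; this is
    where f >= 0 enters. *)
Lemma ge0_improper_FTC (f F : R -> R) (L0 L1 : R) :
  measurable_fun setT f ->
  (forall x, -1 <= x <= 1 -> 0 <= f x) ->
  (forall x, -1 < x < 1 -> drv F x (f x)) ->
  (forall x, -1 < x < 1 -> {for x, continuous f}) ->
  F (1 - e n) @[n --> \oo] --> L1 -> F (-1 + e n) @[n --> \oo] --> L0 ->
  (\int[mu]_(x in I) (f x)%:E = (L1 - L0)%:E)%E.
Proof.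
move=> mf f0 dF cf F1 F0.
have mfE (D : set R) : measurable_fun D (EFin \o f).
  by apply/measurable_EFinP; apply: measurable_funTS.
rewrite -integral_itv_bndo_bndc // -integral_itv_obnd_cbnd // -bigcup_F.
(* The half in [endpoint_gap] makes this strict already at n = 0. *)
have en1 n : -1 + e n < 1 - e n by have := e_le n; lra.
have sub n x : -1 + e n <= x <= 1 - e n -> -1 < x < 1.
  by move=> /andP[h1 h2]; have e0 := e_gt0 n; apply/andP; split; lra.
have h1 : (\int[mu]_(x in F_ n) (f x)%:E)%E @[n --> \oo] -->
    (\int[mu]_(x in \bigcup_n F_ n) (f x)%:E)%E.
  apply: ge0_nondecreasing_set_cvg_integral => //.
  - move=> m n mn; rewrite subsetEset; apply: subset_itvScc.
      rewrite bnd_simp lerD2l /endpoint_gap ler_wpM2r // lef_pV2 ?posrE ?ltr0n //.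
      by rewrite ler_nat.
    rewrite bnd_simp lerD2l lerN2 /endpoint_gap ler_wpM2r // lef_pV2 ?posrE ?ltr0n //.
    by rewrite ler_nat.
  - by move=> n; exact: measurable_itv.
  - by move=> n; exact: mfE.
  - move=> n x; rewrite /F_ /= in_itv /= => /sub /andP[/ltW a1 /ltW a2].
    by rewrite lee_fin f0 // a1 a2.
have h2 n : (\int[mu]_(x in F_ n) (f x)%:E)%E = (F (1 - e n) - F (-1 + e n))%:E.
  rewrite EFinB; apply: continuous_FTC2 => //.
  - apply: continuous_in_subspaceT => x; rewrite inE /= in_itv /= => hx.
    exact: cf (sub _ _ hx).
  - split.
    + move=> x; rewrite in_itv /= => /andP[/ltW a1 /ltW a2].
      by have [] := dF x (sub n x _); rewrite ?a1 ?a2.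
    + apply: cvg_at_right_filter; apply: (@drv_continuous _ _ _ (f _)).
      by apply: dF; apply: (sub n); rewrite lexx ltW.
    + apply: cvg_at_left_filter; apply: (@drv_continuous _ _ _ (f _)).
      by apply: dF; apply: (sub n); rewrite lexx ltW.
  - move=> x; rewrite in_itv /= => /andP[/ltW a1 /ltW a2].
    have dFx : is_derive x 1 F (f x) by apply: dF; apply: (sub n); rewrite a1 a2.
    by rewrite derive1E derive_val.
have h3 : (F (1 - e n) - F (-1 + e n))%:E @[n --> \oo] --> (L1 - L0)%:E.
  by apply: cvg_EFin; [exact: nearW|exact: cvgB F1 F0].
have h4 : (\int[mu]_(x in F_ n) (f x)%:E)%E @[n --> \oo] --> (L1 - L0)%:E.
  rewrite (_ : (fun n => (\int[mu]_(x in F_ n) (f x)%:E)%E) =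
    (fun n => (F (1 - e n) - F (-1 + e n))%:E)) //.
  by apply/funext => n; exact: h2.
exact: etrans (esym (cvg_lim (@ereal_hausdorff R) h1)) (cvg_lim (@ereal_hausdorff R) h4).
Qed.

Lemma cvg_powR_e (p : R) : 0 < p -> (e n) `^ p @[n --> \oo] --> (0 : R).
Proof.
move=> p0; have /cvg_at_rightP := powR_cvg0 p0; apply; split => //.
Qed.

Lemma cvg_addr_e (f : R -> R) (x : R) : {for x, continuous f} ->
  f (x + e n) @[n --> \oo] --> f x.
Proof.
move=> cf; have h : x + e n @[n --> \oo] --> x + 0.
  by apply: cvgD; [exact: cvg_cst|exact: cvg_e].
by rewrite addr0 in h; exact: continuous_cvg.
Qed.

Lemma cvg_subr_e (f : R -> R) (x : R) : {for x, continuous f} ->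
  f (x - e n) @[n --> \oo] --> f x.
Proof.
move=> cf; have h : x - e n @[n --> \oo] --> x - 0.
  by apply: cvgB; [exact: cvg_cst|exact: cvg_e].
by rewrite subr0 in h; exact: continuous_cvg.
Qed.

End ImproperFTC.

(** * Integration of polynomials against the Jacobi weight *)

Section JacobiFunctional.
Variables (R : realType) (a b : R).
Hypotheses (ha : -1 / 2 <= a <= 1 / 2) (hb : -1 / 2 <= b <= 1 / 2).
Local Notation mu := (@lebesgue_measure R).
Local Notation I := (`[-1, 1]%classic : set R).
Implicit Types (p q : {poly R}) (x : R).

Let w := jacobi_weight a b.
(** A majorant of the weight up to a factor, with the elementary antiderivative [W0]: on each half
    of the interval only one factor of w can blow up, and the other is at most 2. *)
Let w0 x : R := (1 - x) `^ a + (1 + x) `^ b.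
Local Notation e := (@endpoint_gap R).

Let w_ge0 x : 0 <= w x. Proof. by rewrite mulr_ge0 ?powR_ge0. Qed.
Let w0_ge0 x : 0 <= w0 x. Proof. by rewrite addr_ge0 ?powR_ge0. Qed.

Let a1 : 0 < a + 1. Proof. by have /andP[] := ha; lra. Qed.
Let b1 : 0 < b + 1. Proof. by have /andP[] := hb; lra. Qed.

Let powR_le2 (t c : R) : c <= 1 / 2 -> 1 <= t <= 2 -> t `^ c <= 2.
Proof.
move=> c2 /andP[t1 t2]; apply: (@le_trans _ _ (t `^ 1)).
  by apply: ler_powR => //; lra.
by rewrite powRr1 // (le_trans _ t1).
Qed.

Let w_le x : -1 <= x <= 1 -> w x <= 2 * w0 x.
Proof.
move=> /andP[x1 x2]; rewrite /w /w0 /jacobi_weight.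
have pa := powR_ge0 (1 - x) a; have pb := powR_ge0 (1 + x) b.
have /andP[_ ha2] := ha; have /andP[_ hb2] := hb.
have [x0|/ltW x0] := leP x 0.
  have : (1 - x) `^ a <= 2 by apply: powR_le2 => //; apply/andP; split; lra.
  by move=> /(ler_wpM2r pb); lra.
have : (1 + x) `^ b <= 2 by apply: powR_le2 => //; apply/andP; split; lra.
by move=> /(ler_wpM2l pa); lra.
Qed.

Let mpow (c s : R) : measurable_fun setT (fun x : R => (1 + s * x) `^ c).
Proof.
apply: (measurableT_comp (measurable_powR c)).
by apply: measurable_funD => //; exact: measurable_funM.
Qed.

Let mpowB (c : R) : measurable_fun setT (fun x : R => (1 - x) `^ c).
Proof. by have := mpow c (-1); under eq_fun do rewrite mulN1r. Qed.

Let mpowD (c : R) : measurable_fun setT (fun x : R => (1 + x) `^ c).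
Proof. by have := mpow c 1; under eq_fun do rewrite mul1r. Qed.

Let mw : measurable_fun setT w.
Proof. by apply: measurable_funM; [exact: mpowB|exact: mpowD]. Qed.

Let mw0 : measurable_fun setT w0.
Proof. by apply: measurable_funD; [exact: mpowB|exact: mpowD]. Qed.

Let mwp p : measurable_fun setT (fun x => w x * p.[x]).
Proof. by apply: measurable_funM => //; exact: measurable_poly. Qed.

Let xB x : -1 < x < 1 -> 0 < 1 - x. Proof. by move=> /andP[? ?]; lra. Qed.
Let xD x : -1 < x < 1 -> 0 < 1 + x. Proof. by move=> /andP[? ?]; lra. Qed.

Let W0 x : R := (1 + x) `^ (b + 1) / (b + 1) - (1 - x) `^ (a + 1) / (a + 1).

Let drvW0 x : -1 < x < 1 -> drv W0 x (w0 x).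
Proof.
move=> hx; have B0 : 1 - x != 0 by rewrite gt_eqF ?xB.
have D0 : 1 + x != 0 by rewrite gt_eqF ?xD.
have a0 : a + 1 != 0 by rewrite gt_eqF.
have b0 : b + 1 != 0 by rewrite gt_eqF.
rewrite /W0 /w0; auto_drv; [exact: xD|exact: xB|].
rewrite /= !powRD ?B0 ?D0 ?implybT // !powRr1 ?(ltW (xB hx)) ?(ltW (xD hx)) //.
by field; rewrite B0 D0 a0 b0.
Qed.

(** The weight times (1 - x^2) p. It tends to 0 at both ends because a + 1 and b + 1 are positive,
    and its derivative is w times the polynomial [stokes p]. *)
Let Fp p x : R := (1 - x) `^ (a + 1) * (1 + x) `^ (b + 1) * p.[x].
Let stokes p : {poly R} :=
  (1 - 'X ^+ 2) * p^`() + ((b - a)%:P - (a + b + 2)%:P * 'X) * p.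

Let drvFp p x : -1 < x < 1 -> drv (Fp p) x (w x * (stokes p).[x]).
Proof.
move=> hx; have B0 : 1 - x != 0 by rewrite gt_eqF ?xB.
have D0 : 1 + x != 0 by rewrite gt_eqF ?xD.
rewrite /Fp /w /jacobi_weight; auto_drv; [exact: xB|exact: xD|].
rewrite /= !powRD ?B0 ?D0 ?implybT // !powRr1 ?(ltW (xB hx)) ?(ltW (xD hx)) //.
have -> : (stokes p).[x] =
    (1 - x ^+ 2) * p^`().[x] + ((b - a) - (a + b + 2) * x) * p.[x].
  by rewrite /stokes !hornerE.
by field; rewrite B0 D0.
Qed.

Let cont_pow (c x : R) : -1 < x < 1 ->
  {for x, continuous (fun t : R => (1 - t) `^ c)} /\
  {for x, continuous (fun t : R => (1 + t) `^ c)}.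
Proof.
move=> hx; split; eapply drv_continuous; auto_drv_core.
  exact: xB.
exact: xD.
Qed.

Let cont_w0 x : -1 < x < 1 -> {for x, continuous w0}.
Proof.
move=> hx; have [h1 _] := cont_pow a hx; have [_ h2] := cont_pow b hx.
exact: continuousD.
Qed.

Let cont_wp p x : -1 < x < 1 -> {for x, continuous (fun t => w t * p.[t])}.
Proof.
move=> hx; have [h1 _] := cont_pow a hx; have [_ h2] := cont_pow b hx.
by apply: continuousM; [exact: continuousM|exact: continuous_horner].
Qed.

Let cvg1 (c : R) : 0 < c -> (1 - (1 - e n)) `^ c @[n --> \oo] --> (0 : R).
Proof.
by move=> c0; under eq_fun do rewrite opprB addrC subrK; exact: cvg_powR_e.
Qed.

Let cvg1' (c : R) : 0 < c -> (1 + (-1 + e n)) `^ c @[n --> \oo] --> (0 : R).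
Proof.
by move=> c0; under eq_fun do rewrite addNKr; exact: cvg_powR_e.
Qed.

Let cvg2 (c : R) : (1 + (1 - e n)) `^ c @[n --> \oo] --> (2 : R) `^ c.
Proof.
have cf : {for (1 : R), continuous (fun t : R => (1 + t) `^ c)}.
  by eapply drv_continuous; auto_drv_core; rewrite addr_gt0.
exact: cvg_subr_e cf.
Qed.

Let cvg2' (c : R) : (1 - (-1 + e n)) `^ c @[n --> \oo] --> (2 : R) `^ c.
Proof.
have cf : {for (-1 : R), continuous (fun t : R => (1 - t) `^ c)}.
  by eapply drv_continuous; auto_drv_core; rewrite opprK addr_gt0.
have -> : (2 : R) = 1 - (-1) by rewrite opprK.
exact: cvg_addr_e cf.
Qed.

Let cvgp1 p : p.[1 - e n] @[n --> \oo] --> p.[1].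
Proof. by apply: cvg_subr_e; exact: continuous_horner. Qed.

Let cvgp0 p : p.[-1 + e n] @[n --> \oo] --> p.[-1].
Proof. by apply: cvg_addr_e; exact: continuous_horner. Qed.

Let W01 := (2 : R) `^ (b + 1) / (b + 1) - 0 / (a + 1).
Let W00 := 0 / (b + 1) - (2 : R) `^ (a + 1) / (a + 1).

Let cvgW1 : W0 (1 - e n) @[n --> \oo] --> W01.
Proof.
by apply: cvgB; apply: cvgM; [exact: cvg2|exact: cvg_cst|exact: cvg1|exact: cvg_cst].
Qed.

Let cvgW0 : W0 (-1 + e n) @[n --> \oo] --> W00.
Proof.
by apply: cvgB; apply: cvgM; [exact: cvg1'|exact: cvg_cst|exact: cvg2'|exact: cvg_cst].
Qed.

Let cvgF1 p : Fp p (1 - e n) @[n --> \oo] --> (0 : R).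
Proof.
have -> : (0 : R) = 0 * 2 `^ (b + 1) * p.[1] by rewrite !mul0r.
by apply: cvgM; [apply: cvgM; [exact: cvg1|exact: cvg2]|exact: cvgp1].
Qed.

Let cvgF0 p : Fp p (-1 + e n) @[n --> \oo] --> (0 : R).
Proof.
have -> : (0 : R) = 2 `^ (a + 1) * 0 * p.[-1] by rewrite mulr0 mul0r.
by apply: cvgM; [apply: cvgM; [exact: cvg2'|exact: cvg1']|exact: cvgp0].
Qed.

Let int_w0 (c : R) : 0 <= c ->
  (\int[mu]_(x in I) (c * w0 x)%:E = (c * W01 - c * W00)%:E)%E.
Proof.
move=> c0; apply: (@ge0_improper_FTC _ _ (fun x => c * W0 x)).
- exact: measurable_funM.
- by move=> x _; rewrite mulr_ge0.
- move=> x hx; apply: drv_eq (drvM (drvC c x) (drvW0 hx)) _.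
  by rewrite mul0r add0r.
- by move=> x hx; apply: continuousM; [exact: cvg_cst|exact: cont_w0].
- by apply: cvgM; [exact: cvg_cst|exact: cvgW1].
- by apply: cvgM; [exact: cvg_cst|exact: cvgW0].
Qed.

Let integrable_w0 (c : R) : 0 <= c ->
  mu.-integrable I (EFin \o (fun x => c * w0 x)).
Proof.
move=> c0; apply/integrableP; split.
  by apply/measurable_EFinP; apply: measurable_funTS; exact: measurable_funM.
under eq_integral do rewrite /= ger0_norm ?mulr_ge0 //.
by rewrite int_w0 // ltry.
Qed.

Let poly_bound p : exists2 M : R, 0 <= M & forall x, -1 <= x <= 1 -> `|p.[x]| <= M.
Proof.
elim/poly_ind: p => [|p c [M M0 hM]].
  by exists 0 => // x _; rewrite horner0 normr0.
exists (M + `|c|); first by rewrite addr_ge0.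
move=> x hx; rewrite hornerMXaddC (le_trans (ler_normD _ _)) // lerD2r normrM.
rewrite -[leRHS]mulr1; apply: ler_pM => //; first exact: hM.
by rewrite ler_norml.
Qed.

Let wp_bound p : exists2 M : R, 0 <= M &
  forall x, -1 <= x <= 1 -> `|w x * p.[x]| <= M * w0 x.
Proof.
have [M M0 hM] := poly_bound p; exists (2 * M); first by rewrite mulr_ge0.
move=> x hx; rewrite normrM ger0_norm // mulrC [2 * M]mulrC -mulrA.
by apply: ler_pM => //; [exact: hM|exact: w_le].
Qed.

Lemma jacobi_integrable p :
  mu.-integrable `[-1, 1] (EFin \o (fun x => jacobi_weight a b x * p.[x])).
Proof.
have [M M0 hM] := wp_bound p.
apply: le_integrable (integrable_w0 M0) => //.
  by apply/measurable_EFinP; apply: measurable_funTS; exact: mwp.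
move=> x; rewrite /= in_itv /= => hx.
by rewrite lee_fin (le_trans (hM x hx)) // ler_norm.
Qed.

Definition jacobi_functional p : R :=
  \int[mu]_(x in `[-1, 1]) (jacobi_weight a b x * p.[x]).

Lemma jacobi_functionalD p q :
  jacobi_functional (p + q) = jacobi_functional p + jacobi_functional q.
Proof.
rewrite /jacobi_functional -RintegralD //; try exact: jacobi_integrable.
by apply: eq_Rintegral => x _; rewrite hornerD mulrDr.
Qed.

Lemma jacobi_functionalZ (c : R) p :
  jacobi_functional (c *: p) = c * jacobi_functional p.
Proof.
rewrite /jacobi_functional -RintegralZl //; last exact: jacobi_integrable.
by apply: eq_Rintegral => x _; rewrite hornerZ mulrCA.
Qed.

(* Adding a multiple of the integrable majorant w0 reduces this to the
   improper fundamental theorem for nonnegative integrands. *)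
Lemma jacobi_functional_stokes p :
  jacobi_functional
    ((1 - 'X ^+ 2) * p^`() + ((b - a)%:P - (a + b + 2)%:P * 'X) * p) = 0.
Proof.
rewrite -/(stokes p); have [M M0 hM] := wp_bound (stokes p).
have iw := jacobi_integrable (stokes p); have iw0 := integrable_w0 M0.
have h : (\int[mu]_(x in I) (w x * (stokes p).[x] + M * w0 x)%:E =
    ((0 + M * W01) - (0 + M * W00))%:E)%E.
  apply: (@ge0_improper_FTC _ _ (fun x => Fp p x + M * W0 x)).
  - by apply: measurable_funD; [exact: mwp|exact: measurable_funM].
  - move=> x /hM; rewrite ler_norml => /andP[h _]; lra.
  - move=> x hx; apply: drv_eq (drvD (drvFp p hx) (drvM (drvC M x) (drvW0 hx))) _.
    by rewrite mul0r add0r.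
  - move=> x hx; apply: continuousD; first exact: cont_wp.
    by apply: continuousM; [exact: cvg_cst|exact: cont_w0].
  - apply: cvgD; first exact: cvgF1.
    by apply: cvgM; [exact: cvg_cst|exact: cvgW1].
  - apply: cvgD; first exact: cvgF0.
    by apply: cvgM; [exact: cvg_cst|exact: cvgW0].
have h1 : \int[mu]_(x in I) (w x * (stokes p).[x] + M * w0 x) =
    M * W01 - M * W00 by rewrite /Rintegral h !add0r.
have h2 : \int[mu]_(x in I) (M * w0 x) = M * W01 - M * W00.
  by rewrite /Rintegral int_w0.
move: h1; rewrite RintegralD // h2 -/(jacobi_functional _) => /eqP.
by rewrite -subr_eq0 addrK => /eqP.
Qed.

Lemma jacobi_functional_sqr_eq0 p : jacobi_functional (p * p) = 0 -> p = 0.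
Proof.
move=> h; apply/eqP; apply: contraT => p0.
have [x0 hx0 px0] : exists2 x0, -1 < x0 < 1 & p.[x0] != 0.
  (* These are [size p] distinct points of ]0, 1[, one more than the degree of p, so one of them is
     not a root. *)
  pose rs := [seq (k.+2%:R^-1 : R) | k <- iota 0 (size p)].
  have urs : uniq rs.
    rewrite map_inj_uniq ?iota_uniq // => i j /invr_inj /eqP.
    by rewrite eqr_nat => /eqP [].
  have [/(max_poly_roots p0)|] := boolP (all (root p) rs).
    by move=> /(_ urs); rewrite size_map size_iota ltnn.
  move=> /allPn[y /mapP[k _ ->] pk]; exists (k.+2%:R^-1) => //.
  have k2 : (0 : R) < k.+2%:R by rewrite ltr0n.
  apply/andP; split; first by rewrite (lt_trans _ (_ : 0 < _)) ?oppr_lt0 ?invr_gt0.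
  by rewrite invf_lt1 // ltr1n.
pose g x := w x * (p * p).[x].
have g_ge0 x : 0 <= g x by rewrite /g hornerM mulr_ge0 // -expr2 sqr_ge0.
have g0 : 0 < g x0.
  rewrite /g hornerM mulr_gt0 //; first by rewrite mulr_gt0 ?powR_gt0 ?xB ?xD.
  by rewrite -expr2 lt_neqAle eq_sym sqrf_eq0 px0 sqr_ge0.
have cg : {for x0, continuous g} := @cont_wp (p * p) x0 hx0.
pose m := g x0 / 2.
have m0 : 0 < m by rewrite divr_gt0.
have near_m : \forall x \near x0, m < g x.
  have mg0 : m < g x0 by rewrite /m ltr_pdivrMr // ltr_pMr // ltr1n.
  by move: cg => /cvgr_gt; apply.
have near_i : \forall x \near x0, -1 < x < 1.
  have /andP[l1 l2] := hx0.
  by near=> x; apply/andP; split; near: x; [exact: lt_nbhsr|exact: lt_nbhsl].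
have [d /= d0 hd] : nbhs x0 [set x | m < g x /\ -1 < x < 1].
  by apply: filterS2 near_m near_i => x.
pose u := x0 - d / 2; pose v := x0 + d / 2.
have uv x : u <= x <= v -> m < g x /\ -1 < x < 1.
  move=> /andP[ux xv]; apply: hd; rewrite /= ltr_norml.
  by rewrite /u in ux; rewrite /v in xv; apply/andP; split; lra.
have uv_le : u < v by rewrite /u /v; lra.
have int0 : (\int[mu]_(x in I) (g x)%:E)%E = 0%E.
  rewrite -[LHS]fineK; last exact: integrable_fin_num (jacobi_integrable (p * p)).
  by move: h; rewrite /jacobi_functional /Rintegral /g => ->.
have mg (D : set R) : measurable_fun D (EFin \o g).
  by apply/measurable_EFinP; apply: measurable_funTS; exact: mwp.
have : (\int[mu]_(x in `[u, v]) (m)%:E <= 0)%E.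
  rewrite -int0; apply: (@le_trans _ _ (\int[mu]_(x in `[u, v]) (g x)%:E)%E).
    apply: ge0_le_integral => //.
    - by move=> x _; rewrite lee_fin ltW.
    - exact: mg.
    - move=> x; rewrite /= in_itv /= => /uv[/ltW mgx _].
      by rewrite lee_fin.
  apply: ge0_subset_integral => //; first exact: mg.
    by move=> x _; rewrite lee_fin.
  move=> x; rewrite /= !in_itv /= => /uv[_ /andP[/ltW -> /ltW ->]].
  by [].
have muE : mu `[u, v]%classic = (v - u)%:E.
  by rewrite lebesgue_measure_itv /= lte_fin uv_le.
rewrite (_ : (\int[mu]_(x in `[u, v]) m%:E)%E = (m%:E * mu `[u, v]%classic)%E); last first.
  exact: (@integral_cst _ _ _ mu _ (measurable_itv `[u, v]) m%:E).
rewrite muE -EFinM lee_fin.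
by rewrite leNgt mulr_gt0 // subr_gt0.
Unshelve. all: by end_near. Qed.

End JacobiFunctional.

(** * The Jacobi differential equation from orthogonality *)

Section JacobiODE.
Variables (R : realType) (a b : R).
Hypotheses (ha : -1 / 2 <= a <= 1 / 2) (hb : -1 / 2 <= b <= 1 / 2).
Variable P : nat -> {poly R}.
Hypothesis hP : is_jacobi_family a b P.
Implicit Types p q : {poly R}.

Local Notation l := (jacobi_functional a b).

Let lD p q : l (p + q) = l p + l q. Proof. exact: jacobi_functionalD. Qed.
Let lZ c p : l (c *: p) = c * l p. Proof. exact: jacobi_functionalZ. Qed.
Let lB p q : l (p - q) = l p - l q.
Proof. by rewrite -scaleN1r lD lZ mulN1r. Qed.
Let l0 : l 0 = 0. Proof. by rewrite -(scale0r 0) lZ mul0r. Qed.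

Lemma jacobi_orthogonal n q : (size q <= n)%N -> l (q * P n) = 0.
Proof.
have [sz orth] := hP.
have lPP m : (m < n)%N -> l (P m * P n) = 0.
  move=> mn; rewrite -[RHS](orth m n _); last first.
    by move=> mn'; rewrite mn' ltnn in mn.
  by apply: eq_Rintegral => x _; rewrite hornerM mulrA.
suff H m : (m <= n)%N -> forall q, (size q <= m)%N -> l (q * P n) = 0.
  exact: H.
elim: m => [_ {}q|m ih mn {}q hq].
  by rewrite leqn0 size_poly_eq0 => /eqP ->; rewrite mul0r l0.
have Pm0 : (P m)`_m != 0.
  have : lead_coef (P m) != 0 by rewrite lead_coef_eq0 -size_poly_eq0 sz.
  by rewrite /lead_coef sz.
pose c := q`_m / (P m)`_m.
have hq' : (size (q - c *: P m)%R <= m)%N.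
  apply/leq_sizeP => j; rewrite leq_eqVlt => /orP[/eqP <-|mj].
    by rewrite coefB coefZ /c divfK // subrr.
  rewrite coefB coefZ [q`_j]nth_default ?(leq_trans hq) //.
  by rewrite nth_default ?sz // mulr0 subr0.
have -> : q * P n = (q - c *: P m) * P n + c *: (P m * P n).
  by rewrite mulrBl scalerAl subrK.
by rewrite lD lZ lPP // mulr0 addr0 ih // ltnW.
Qed.

Let L p : {poly R} :=
  (1 - 'X ^+ 2) * p^`()^`() + ((b - a)%:P - (a + b + 2)%:P * 'X) * p^`().

(** The difference (L p) q - p (L q) is the Stokes expression of p' q - p q', whose integral
    vanishes. *)
Let L_sym p q : l (L p * q) = l (p * L q).
Proof.
apply/eqP; rewrite -subr_eq0 -lB; apply/eqP.
rewrite -[RHS](jacobi_functional_stokes ha hb (p^`() * q - p * q^`())).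
congr (jacobi_functional _ _ _).
by rewrite /L derivB !derivM; ring.
Qed.

Let coefL p i : (L p)`_i = p`_i.+2 * (i.+1 * i.+2)%:R + (b - a) * (p`_i.+1 * i.+1%:R)
  - (i%:R * (i%:R - 1) + (a + b + 2) * i%:R) * p`_i.
Proof.
have cd (u : {poly R}) j : u^`()`_j = u`_j.+1 * j.+1%:R by rewrite coef_deriv mulr_natr.
have -> : L p = p^`()^`() - 'X^2 * p^`()^`() +
    ((b - a)%:P * p^`() - (a + b + 2)%:P * ('X * p^`())) by rewrite /L; ring.
rewrite !coefD !coefN coefXnM !coefCM coefXM !cd natrM.
case: i => [|[|i]] /=.
- by ring.
- by ring.
rewrite subSS subn1 /=.
have e1 : i.+1%:R = i%:R + 1 :> R by rewrite -natr1.
have e2 : i.+2%:R = i%:R + 1 + 1 :> R by rewrite -!natr1.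
have e3 : i.+3%:R = i%:R + 1 + 1 + 1 :> R by rewrite -!natr1.
have e4 : i.+4%:R = i%:R + 1 + 1 + 1 + 1 :> R by rewrite -!natr1.
rewrite e4 e3 e2 e1.
move: (i%:R : R) (p`_i.+4) (p`_i.+3) (p`_i.+2) => x u v w; ring.
Qed.

(** [lam] cancels the leading coefficients, so S = L (P n) + lam P n has degree below n. By symmetry
    l (S S) = l ((L S) (P n)) + lam l (S (P n)), and both terms vanish by orthogonality, as L does
    not raise degrees. Definiteness gives S = 0. *)
Lemma jacobi_ode n :
  (1 - 'X ^+ 2) * (P n)^`()^`() + ((b - a)%:P - (a + b + 2)%:P * 'X) * (P n)^`()
    + (n%:R * (n%:R + a + b + 1))%:P * P n = 0.
Proof.
rewrite -/(L (P n)); set lam := n%:R * _.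
have [sz _] := hP.
have szL q : (size q <= n)%N -> (size (L q) <= n)%N.
  move=> hq; apply/leq_sizeP => j nj.
  by rewrite coefL !nth_default ?mul0r ?mulr0 ?addr0 ?subr0 //;
    apply: leq_trans hq (leq_trans nj _) => //; rewrite ?leqnSn // leqW.
have szS : (size (L (P n) + lam%:P * P n)%R <= n)%N.
  apply/leq_sizeP => j nj; rewrite coefD coefCM coefL.
  have c1 : (P n)`_j.+1 = 0 by apply: nth_default; rewrite sz ltnS.
  have c2 : (P n)`_j.+2 = 0 by apply: nth_default; rewrite sz ltnS leqW.
  rewrite c1 c2.
  move: nj; rewrite leq_eqVlt => /orP[/eqP <-|nj].
    by rewrite /lam; ring.
  by rewrite [(P n)`_j]nth_default ?sz // !mul0r !mulr0 addr0 subr0 addr0.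
apply: (jacobi_functional_sqr_eq0 ha hb).
set S := _ + _ in szS *.
rewrite {2}/S mulrDr lD mul_polyC -scalerAr lZ jacobi_orthogonal // mulr0 addr0.
by rewrite mulrC L_sym mulrC jacobi_orthogonal ?szL.
Qed.

End JacobiODE.

(** * The weighted polynomial on the closed interval, reflection, and points of equality *)

Definition jacobi_equation (R : realType) (r s : R) (n : nat) (Q : {poly R}) :=
  (1 - 'X ^+ 2) * Q^`()^`()
  + ((2 * (s - r))%:P - (2 * r + 2 * s + 1)%:P * 'X) * Q^`()
  + (n%:R * (n%:R + 2 * r + 2 * s))%:P * Q = 0.

Definition jacobi_extremal (R : realType) (n : nat) (z : 'I_n -> R) (r s x : R) : R :=
  (1 - x) `^ r * (1 + x) `^ s * `|\prod_(k < n) (x - z k)|.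

Section Extremal.
Variable R : realType.
Implicit Types (r s x t : R) (n : nat).

(** At negative arguments [powR] takes only conventional values. The absolute value gives a function
    continuous on the whole line that agrees with t^r for the arguments 1 - x and 1 + x in question;
    for r = 0 it is 1 at t = 0 as well. *)
Lemma normr_powR_continuous r : 0 <= r -> continuous (fun t : R => `|t| `^ r).
Proof.
rewrite le_eqVlt => /orP[/eqP <-|r0] t.
  by under eq_fun do rewrite powRr0; exact: cvg_cst.
have [->|t0] := eqVneq t 0.
  apply/cvgrPdist_lt => e e0; rewrite normr0 powR0 ?gt_eqF //.
  near=> u; rewrite sub0r normrN ger0_norm ?powR_ge0 //.
  have -> : e = (e `^ r^-1) `^ r by rewrite -powRrM mulVf ?gt_eqF // powRr1 ?ltW.
  apply: gt0_ltr_powR => //; rewrite ?nnegrE ?powR_ge0 //.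
  near: u; exists (e `^ r^-1) => /=; first exact: powR_gt0.
  by move=> u /=; rewrite sub0r normrN.
have cn : {for t, continuous (fun u : R => `|u|)} by exact: norm_continuous.
have cp : {for `|t|, continuous (fun u : R => u `^ r)}.
  have t0' : 0 < `|t| by rewrite normr_gt0.
  have d : drv (fun u => u `^ r) `|t| _ :=
    @drv_powR R (fun u => u) `|t| 1 r t0' (drv_id `|t|).
  exact: drv_continuous d.
exact: continuous_comp cn cp.
Unshelve. all: by end_near. Qed.

Lemma within_itv_continuous (f g : R -> R) :
  (forall x, -1 <= x <= 1 -> f x = g x) -> continuous g ->
  {within `[-1, 1], continuous f}.
Proof.
move=> fg cg; apply: (@subspace_eq_continuous _ _ _ g); last first.
  exact: continuous_subspaceT.
by move=> x; rewrite inE /= in_itv /= => hx; rewrite /from_subspace /= fg.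
Qed.

Lemma continuous_le_endpoints (f : R -> R) (M : R) : continuous f ->
  (forall x, -1 < x < 1 -> f x <= M) -> forall x, -1 <= x <= 1 -> f x <= M.
Proof.
move=> cf h x /andP[]; rewrite le_eqVlt => /orP[/eqP <- _|x1].
  have c1 : f t @[t --> (-1 : R)^'+] --> f (-1) by apply: cvg_at_right_filter; exact: cf.
  apply: cvgr_to_le c1 _; near=> t; apply: h; apply/andP; split.
    by near: t; exact: nbhs_right_gt.
  by near: t; apply: nbhs_right_lt; rewrite (lt_trans _ (_ : 0 < _)) ?oppr_lt0.
rewrite le_eqVlt => /orP[/eqP ->|x2]; last by apply: h; rewrite x1.
have c1 : f t @[t --> (1 : R)^'-] --> f 1 by apply: cvg_at_left_filter; exact: cf.
apply: cvgr_to_le c1 _; near=> t; apply: h; apply/andP; split.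
  by near: t; apply: nbhs_left_gt; rewrite (lt_trans _ (_ : 0 < _)) ?oppr_lt0.
by near: t; exact: nbhs_left_lt.
Unshelve. all: by end_near. Qed.

Section Fixed.
Variables (n : nat) (z : 'I_n -> R) (r s : R).
Hypotheses (hz : forall k, -1 <= z k <= 1) (n1 : (0 < n)%N)
  (hr : 0 <= r <= 1 / 2) (hs : 0 <= s <= 1 / 2).
Let Q : {poly R} := \prod_(k < n) ('X - (z k)%:P).
Hypothesis ode : jacobi_equation r s n Q.
Let N : R := n%:R + r + s.
Local Notation v := (jacobi_extremal z r s).

Let QE x : Q.[x] = \prod_(k < n) (x - z k).
Proof. by rewrite horner_prod; apply: eq_bigr => k _; rewrite hornerXsubC. Qed.

Lemma jacobi_extremal_ge0 x : 0 <= v x.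
Proof. by rewrite !mulr_ge0 ?powR_ge0. Qed.

Lemma jacobi_extremal_sqr x : v x ^+ 2 = jweight r s x * Q.[x] ^+ 2.
Proof.
have sq (t p : R) : (t `^ p) ^+ 2 = t `^ (2 * p).
  by rewrite -powR_mulrn ?powR_ge0 // -powRrM mulrC.
by rewrite /jacobi_extremal !exprMn !sq real_normK ?num_real // QE.
Qed.

Let vabs x := `|1 - x| `^ r * `|1 + x| `^ s * `|Q.[x]|.

Let vabsE x : -1 <= x <= 1 -> v x = vabs x.
Proof.
move=> /andP[x1 x2]; rewrite /jacobi_extremal /vabs QE.
by rewrite [`|1 - x|]ger0_norm ?[`|1 + x|]ger0_norm //; lra.
Qed.

Let cont_pows x : {for x, continuous (fun x : R => `|1 - x| `^ r * `|1 + x| `^ s)}.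
Proof.
have /andP[r0 _] := hr; have /andP[s0 _] := hs.
apply: continuousM.
  apply: (@continuous_comp _ _ _ (fun x => 1 - x) (fun t => `|t| `^ r)).
    by apply: continuousB; [exact: cvg_cst|exact: cvg_id].
  exact: normr_powR_continuous.
apply: (@continuous_comp _ _ _ (fun x => 1 + x) (fun t => `|t| `^ s)).
  by apply: continuousD; [exact: cvg_cst|exact: cvg_id].
exact: normr_powR_continuous.
Qed.

Let cvabs x : {for x, continuous vabs}.
Proof.
apply: continuousM; first exact: cont_pows.
apply: (@continuous_comp _ _ _ (fun x => Q.[x]) (fun t => `|t|)).
  exact: continuous_horner.
exact: norm_continuous.
Qed.

Lemma jacobi_extremal_continuous : {within `[-1, 1], continuous v}.
Proof. by apply: (within_itv_continuous vabsE) => x; exact: cvabs. Qed.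

Lemma jacobi_extremal_sqr_le (M : R) :
  (forall x, -1 < x < 1 -> v x ^+ 2 <= M) ->
  forall x, -1 <= x <= 1 -> v x ^+ 2 <= M.
Proof.
move=> h x hx; rewrite vabsE //.
apply: (@continuous_le_endpoints (fun x => vabs x ^+ 2)) hx => [t|t ht].
  apply: (@continuous_comp _ _ _ vabs (fun t => t ^+ 2)); first exact: cvabs.
  exact: exprn_continuous.
have ht' : -1 <= t <= 1 by have /andP[/ltW -> /ltW ->] := ht.
by rewrite -vabsE // h.
Qed.

(** Without the term r / (1 - x), Sonin's function F extends continuously to x = 1. There the factor
    1 - t^2 removes the derivative term, so the constant value is v(1)^2. *)
Lemma extremal_attained_r0 : s * (1 - 2 * s) = 0 -> r = 0 ->
  v 1 ^+ 2 = 4 * 2 `^ (- (2 * N)).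
Proof.
move=> b0 r0.
pose F t := (1 + t) `^ (2 * s) *
  (Q.[t] ^+ 2 + (1 - t ^+ 2) * (s / (1 + t) * Q.[t] + Q^`().[t]) ^+ 2 / N ^+ 2).
have FE t : -1 < t < 1 -> F t = 4 * 2 `^ (- (2 * N)).
  move=> ht; rewrite -(jacobi_sonin_const ode hz n1 hr hs ht _ b0); last first.
    by rewrite r0 mul0r.
  have wE : jweight r s t = (1 + t) `^ (2 * s).
    by rewrite /jweight r0 mulr0 powRr0 mul1r.
  have kE : jslope z r s t = s / (1 + t) * Q.[t] + Q^`().[t].
    by rewrite /jslope r0 oppr0 mul0r add0r.
  by rewrite wE kE.
have F1 : F 1 = v 1 ^+ 2.
  rewrite jacobi_extremal_sqr /F /jweight r0 mulr0 powRr0 mul1r.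
  by rewrite expr1n subrr !mul0r addr0.
have cF : {for (1 : R), continuous F}.
  have p2 : (0 : R) < 1 + 1 by rewrite addr_gt0.
  by rewrite /F; eapply drv_continuous; auto_drv_core; rewrite ?gt_eqF.
have c1 : F t @[t --> (1 : R)^'-] --> F 1 by apply: cvg_at_left_filter; exact: cF.
rewrite -F1; apply/eqP; rewrite eq_le; apply/andP; split.
  apply: cvgr_to_le c1 _; near=> t; rewrite FE //; apply/andP; split.
    by near: t; apply: nbhs_left_gt; rewrite (lt_trans _ (_ : 0 < _)) ?oppr_lt0.
  by near: t; exact: nbhs_left_lt.
apply: cvgr_to_ge c1 _; near=> t; rewrite FE //; apply/andP; split.
  by near: t; apply: nbhs_left_gt; rewrite (lt_trans _ (_ : 0 < _)) ?oppr_lt0.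
by near: t; exact: nbhs_left_lt.
Unshelve. all: by end_near. Qed.

(* Rolle's theorem gives a zero of the derivative k of v up to a positive
   factor, and there Sonin's function reduces to v^2. *)
Lemma extremal_attained_half : r = 1 / 2 -> s = 1 / 2 ->
  exists2 x, -1 <= x <= 1 & v x ^+ 2 = 4 * 2 `^ (- (2 * N)).
Proof.
move=> r2 s2.
have r_neq0 : r != 0 by rewrite r2 gt_eqF // divr_gt0.
have s_neq0 : s != 0 by rewrite s2 gt_eqF // divr_gt0.
pose V x := (1 - x) `^ r * (1 + x) `^ s * Q.[x].
have V1 : V 1 = 0 by rewrite /V subrr powR0 // !mul0r.
have VN1 : V (-1) = 0 by rewrite /V subrr powR0 // mulr0 mul0r.
have dV x : -1 < x < 1 ->
    drv V x ((1 - x) `^ r * (1 + x) `^ s * jslope z r s x).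
  move=> /andP[x1 x2]; have B0 : 0 < 1 - x by lra.
  have D0 : 0 < 1 + x by lra.
  rewrite /V; auto_drv => //.
  by rewrite /jslope -/Q /=; field; rewrite !gt_eqF.
have N11 : (-1 : R) < 1 by rewrite (lt_trans _ (_ : 0 < _)) ?oppr_lt0.
have cV : {within `[-1, 1], continuous V}.
  apply: (@within_itv_continuous V (fun x => `|1 - x| `^ r * `|1 + x| `^ s * Q.[x])).
    move=> x /andP[x1 x2]; rewrite /V.
    by rewrite [`|1 - x|]ger0_norm ?[`|1 + x|]ger0_norm //; lra.
  have c x : {for x, continuous (fun x => `|1 - x| `^ r * `|1 + x| `^ s * Q.[x])}.
    by apply: continuousM; [exact: cont_pows|exact: continuous_horner].
  by move=> x; exact: c.
have dV' x : x \in `]-1, 1[%R -> derivable V x 1.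
  by rewrite in_itv /= => /dV [].
have [x hx Vx] := Rolle N11 dV' cV (etrans VN1 (esym V1)).
rewrite in_itv /= in hx; have /andP[x1 x2] := hx.
have := dV x hx; rewrite /drv => Vx'.
have : (1 - x) `^ r * (1 + x) `^ s * jslope z r s x = 0.
  by rewrite -(@derive_val _ _ _ _ _ _ _ Vx') (@derive_val _ _ _ _ _ _ _ Vx).
move=> /eqP; rewrite !mulf_eq0 !powR_eq0 => k0.
have {}k0 : jslope z r s x = 0.
  have B0 : (1 - x == 0) = false by apply: gt_eqF; lra.
  have D0 : (1 + x == 0) = false by apply: gt_eqF; lra.
  by apply/eqP; move: k0; rewrite B0 D0.
exists x; first by rewrite !ltW.
have ab0 (t : R) : t = 1 / 2 -> t * (1 - 2 * t) = 0 by move=> ->; field.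
rewrite jacobi_extremal_sqr -(jacobi_sonin_const ode hz n1 hr hs hx (ab0 _ r2) (ab0 _ s2)).
by rewrite k0 expr0n /= mulr0 mul0r addr0.
Qed.

End Fixed.

Lemma jacobi_equation_opp n r s (z : 'I_n -> R) :
  jacobi_equation r s n (\prod_(k < n) ('X - (z k)%:P)) ->
  jacobi_equation s r n (\prod_(k < n) ('X - (- z k)%:P)).
Proof.
set Q := \prod_(k < n) _ => ode.
have -> : \prod_(k < n) ('X - (- z k)%:P) = (-1) ^+ n *: (Q \Po (- 'X)) :> {poly R}.
  rewrite /Q rmorph_prod /= -[in (-1) ^+ n](card_ord n) -prodr_const -mul_polyC.
  rewrite rmorph_prod -big_split /=; apply: eq_bigr => k _.
  by rewrite comp_polyB comp_polyX comp_polyC !polyCN polyC1; ring.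
have d p : (p \Po (- 'X))^`() = - (p^`() \Po (- 'X)) :> {poly R}.
  by rewrite deriv_comp derivN derivX mulrN1.
have c1 : 1 \Po (- 'X) = 1 :> {poly R} by rewrite -polyC1 comp_polyC.
rewrite /jacobi_equation !derivZ d derivN !d opprK.
have := congr1 (fun p => p \Po (- 'X)) ode; rewrite comp_poly0 expr2.
have cN p : (- p) \Po (- 'X) = - (p \Po (- 'X)) :> {poly R}.
  by rewrite -[- p]sub0r comp_polyB comp_poly0 sub0r.
rewrite !(comp_polyD, cN, comp_polyM, comp_polyC, comp_polyX, c1) => h.
rewrite -!mul_polyC; transitivity (((-1) ^+ n)%:P * (0 : {poly R})); last by rewrite mulr0.
rewrite -[X in _ = _ * X]h.
rewrite (_ : 2 * (r - s) = - (2 * (s - r))); last by ring.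
rewrite (_ : 2 * s + 2 * r + 1 = 2 * r + 2 * s + 1); last by ring.
rewrite (_ : n%:R + 2 * s + 2 * r = n%:R + 2 * r + 2 * s); last by ring.
by rewrite polyCN; ring.
Qed.

Lemma jacobi_extremal_opp n r s (z : 'I_n -> R) x :
  jacobi_extremal (fun k => - z k) s r (- x) = jacobi_extremal z r s x.
Proof.
rewrite /jacobi_extremal opprK [_ `^ s * _]mulrC; congr (_ * _).
rewrite !normr_prod; apply: eq_bigr => k _.
by rewrite -opprD normrN.
Qed.

(** The gain detects only b. Ordering a <= b by reflection makes b = 0 force a = 0. *)
Lemma jacobi_extremal_bound n (z : 'I_n -> R) r s :
  (forall k, -1 <= z k <= 1) -> (0 < n)%N ->
  0 <= r <= 1 / 2 -> 0 <= s <= 1 / 2 ->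
  jacobi_equation r s n (\prod_(k < n) ('X - (z k)%:P)) ->
  exists g : R, [/\ 0 <= g,
    g = 0 -> r * (1 - 2 * r) = 0 /\ s * (1 - 2 * s) = 0 &
    forall x, -1 <= x <= 1 -> jacobi_extremal z r s x ^+ 2 * (1 + g) <=
      4 * 2 `^ (- (2 * (n%:R + r + s)))].
Proof.
wlog ab : z r s / r * (1 - 2 * r) <= s * (1 - 2 * s) => [wlg hz n1 hr hs ode|].
  have [ab|/ltW ab] := leP (r * (1 - 2 * r)) (s * (1 - 2 * s)); first exact: wlg.
  have hz' k : -1 <= - z k <= 1 by rewrite lerNl opprK lerNl andbC hz.
  have [g [g0 gab hg]] := wlg _ _ _ ab hz' n1 hs hr (jacobi_equation_opp ode).
  exists g; split => // [/gab[? ?] //|x hx].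
  rewrite -jacobi_extremal_opp addrAC; apply: hg.
  by rewrite lerNl opprK lerNl andbC.
move=> hz n1 hr hs ode.
have g0 := jacobi_gain_ge0 n1 hr hs.
exists (2 * jacobi_gain n r s); split; first by rewrite mulr_ge0.
  move=> /eqP; rewrite mulf_eq0 pnatr_eq0 /= => /eqP gE.
  have b0 : 0 <= s * (1 - 2 * s) by have /andP[? ?] := hs; rewrite mulr_ge0 //; lra.
  have a0 : 0 <= r * (1 - 2 * r) by have /andP[? ?] := hr; rewrite mulr_ge0 //; lra.
  have bE : s * (1 - 2 * s) = 0.
    apply/eqP; apply: contraT => bn0.
    have := jacobi_gain_gt0 n1 hr hs; rewrite gE ltxx; apply.
    by rewrite lt_neqAle eq_sym bn0.
  by split => //; apply/eqP; rewrite eq_le a0 -bE ab.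
move=> x hx; have g1 : 0 < 1 + 2 * jacobi_gain n r s.
  by rewrite (lt_le_trans ltr01) // lerDl mulr_ge0.
rewrite -ler_pdivlMr //; apply: jacobi_extremal_sqr_le hx => // t ht.
by rewrite ler_pdivlMr // jacobi_extremal_sqr; exact: jacobi_sqr_le.
Qed.

(** A parameter equal to 0 gives equality at the corresponding endpoint. For r = s = 1/2 both
    endpoint values vanish, and an interior point is required. *)
Lemma jacobi_extremal_attained n (z : 'I_n -> R) r s :
  (forall k, -1 <= z k <= 1) -> (0 < n)%N ->
  (r = 0 \/ r = 1 / 2) -> (s = 0 \/ s = 1 / 2) ->
  jacobi_equation r s n (\prod_(k < n) ('X - (z k)%:P)) ->
  exists2 x, -1 <= x <= 1 &
    jacobi_extremal z r s x ^+ 2 = 4 * 2 `^ (- (2 * (n%:R + r + s))).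
Proof.
move=> hz n1 hr hs ode.
have ab0 (t : R) : t = 0 \/ t = 1 / 2 -> t * (1 - 2 * t) = 0.
  by move=> [->|->]; field.
have itv (t : R) : t = 0 \/ t = 1 / 2 -> 0 <= t <= 1 / 2.
  by move=> [->|->]; rewrite lexx ?andbT //= divr_ge0.
have h11 : -1 <= (1 : R) <= 1 by rewrite lexx andbT (le_trans _ (_ : 0 <= _)) ?oppr_le0.
have [r0|r_half] := hr.
  exists 1 => //; apply: extremal_attained_r0 => //; [exact: itv|exact: itv|exact: ab0].
have [s0|s_half] := hs; last first.
  by apply: extremal_attained_half => //; exact: itv.
exists (-1); first by rewrite lexx /=; have /andP[] := h11.
have hz' k : -1 <= - z k <= 1 by rewrite lerNl opprK lerNl andbC hz.
have := @extremal_attained_r0 n (fun k => - z k) s r hz' n1 (itv _ hs) (itv _ hr)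
  (jacobi_equation_opp ode) (ab0 _ hr) s0.
have -> : n%:R + s + r = n%:R + r + s by rewrite addrAC.
by have := jacobi_extremal_opp r s z (-1); rewrite opprK => ->.
Qed.

End Extremal.

(** * Existence of the maximum and its comparison with the bound *)

Lemma is_max_within_itv (R : realType) (f : R -> R) :
  {within `[-1, 1], continuous f} ->
  exists2 M, is_max [set f x | x in `[-1, 1]] M &
    exists2 x, -1 <= x <= 1 & M = f x.
Proof.
move=> cf; have N11 : (-1 : R) <= 1 by rewrite (le_trans _ (_ : 0 <= _)) ?oppr_le0.
have [c hc cmax] := EVT_max N11 cf.
exists (f c); last by exists c.
split; first by exists c.
by move=> _ [x hx <-]; exact: cmax.
Qed.

Theorem theorem1p3 (R : realType) (alpha beta : R)
  (halpha : -1 < alpha) (hbeta : -1 < beta)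
  (hra : 0 <= rho alpha <= 1 / 2) (hrb : 0 <= rho beta <= 1 / 2)
  (P : nat -> {poly R}) (hP : is_jacobi_family alpha beta P)
  (psi : forall n : nat, 'I_n -> R)
  (hpsi : forall (n : nat) (k : 'I_n), (1 <= n)%N -> 0 <= psi n k <= pi)
  (hzeros : forall n : nat, (1 <= n)%N ->
     are_the_zeros (P n) (fun k : 'I_n => cos (psi n k)))
  (n : nat) (hn : (1 <= n)%N) :
  exists M : R,
    [/\ is_max [set (1 - x) `^ (rho alpha) * (1 + x) `^ (rho beta) *
                    `| \prod_(k < n) (x - cos (psi n k)) | | x in `[-1, 1]] M,
        M <= 2 `^ (1 - n%:R - rho alpha - rho beta)
      & M = 2 `^ (1 - n%:R - rho alpha - rho beta) <->
          ((rho alpha = 0 \/ rho alpha = 1 / 2) /\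
           (rho beta = 0 \/ rho beta = 1 / 2))].
Proof.
set r := rho alpha in hra *; set s := rho beta in hrb *.
have alphaE : alpha = 2 * r - 1 / 2 by rewrite /r /rho; field.
have betaE : beta = 2 * s - 1 / 2 by rewrite /s /rho; field.
have ha : -1 / 2 <= alpha <= 1 / 2.
  by have /andP[? ?] := hra; rewrite alphaE; apply/andP; split; lra.
have hb : -1 / 2 <= beta <= 1 / 2.
  by have /andP[? ?] := hrb; rewrite betaE; apply/andP; split; lra.
pose z (k : 'I_n) := cos (psi n k).
have hz k : -1 <= z k <= 1 by rewrite cos_geN1 cos_le1.
have [Pn0 PnE] := hzeros n hn.
(* Substitute alpha = 2 r - 1/2 and beta = 2 s - 1/2 in the equation of P n; it is linear, so the
   leading coefficient drops out. *)
have ode : jacobi_equation r s n (\prod_(k < n) ('X - (z k)%:P)).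
  have := jacobi_ode ha hb hP n; rewrite PnE !derivZ -!scalerAr -!scalerDr => /eqP.
  rewrite scaler_eq0 lead_coef_eq0 (negbTE Pn0) /= => /eqP.
  rewrite /jacobi_equation (_ : beta - alpha = 2 * (s - r)); last by lra.
  rewrite (_ : alpha + beta + 2 = 2 * r + 2 * s + 1); last by lra.
  by rewrite (_ : n%:R + alpha + beta + 1 = n%:R + 2 * r + 2 * s); last by lra.
set B := 2 `^ (1 - n%:R - r - s).
have B0 : 0 < B by rewrite powR_gt0.
have B2 : B ^+ 2 = 4 * 2 `^ (- (2 * (n%:R + r + s))).
  rewrite -powR_mulrn ?powR_ge0 // -powRrM.
  rewrite (_ : _ * _ = 2%:R + - (2 * (n%:R + r + s))); last by ring.
  rewrite powRD ?pnatr_eq0 ?implybT // powR_mulrn //; congr (_ * _).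
  by rewrite expr2 -natrM.
have [g [g0 gab hg]] := jacobi_extremal_bound hz hn hra hrb ode.
have [M maxM [xM hxM ME]] :=
  is_max_within_itv (jacobi_extremal_continuous (z := z) hra hrb).
have M0 : 0 <= M by rewrite ME jacobi_extremal_ge0.
have Mg : M ^+ 2 * (1 + g) <= B ^+ 2 by rewrite ME B2; exact: hg.
have MB : M <= B.
  rewrite -ler_sqr ?nnegrE ?(ltW B0) //; apply: le_trans Mg.
  by rewrite ler_peMr ?sqr_ge0 // lerDl.
exists M; split => //; split => [eMB|[hr hs]].
  (* Equality turns [Mg] into B^2 (1 + g) <= B^2 with B > 0. *)
  have : g <= 0.
    by move: Mg; rewrite eMB ger_pMr ?exprn_gt0 // gerDl.
  move=> gle0; have /gab[] : g = 0 by apply/eqP; rewrite eq_le gle0 g0.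
  have half (t : R) : t * (1 - 2 * t) = 0 -> t = 0 \/ t = 1 / 2.
    move=> /eqP; rewrite mulf_eq0 => /orP[/eqP ->|/eqP h]; [by left|right; lra].
  by move=> /half ? /half ?.
have [x hx xE] := jacobi_extremal_attained hz hn hr hs ode.
apply/eqP; rewrite eq_le MB /=.
have <- : jacobi_extremal z r s x = B.
  apply/eqP; rewrite -(eqrXn2 (_ : 0 < 2)%N) ?jacobi_extremal_ge0 ?(ltW B0) //.
  by rewrite xE B2.
by apply: maxM.2; exists x => //; rewrite /= in_itv.
Qed.
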